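(* Let $R$ be a commutative ring, let $S$ be an $R$-algebra (not necessarily commutative), let $K$, $L$, $M$, $N$ be right $S$-modules, and let $E:=\mathrm{End}_S(N)$ denote the $R$-algebra of all $S$-linear endomorphisms of $N$. Assume the following: (1) $X:=j\text{-}\mathrm{Spec}(R)\cap \mathrm{Supp}_R(N)$ is a Noetherian subspace of the Zariski space $\mathrm{Spec}(R)$. (2) $N$ is a finitely presented $S$-module, and $E$ is a module-finite $R$-algebra. (3) There is a finitely generated left $E$-submodule $F$ of $\mathrm{Hom}_S(M,N)$ such that, for every $\mathfrak p\in X$, there is a split surjection in $F_{\mathfrak p}^{\oplus(1+\dim_X(\mathfrak p))}\subseteq \mathrm{Hom}_{S_{\mathfrak p}}\bigl(M_{\mathfrak p},N_{\mathfrak p}^{\oplus(1+\dim_X(\mathfrak p))}\bigr)$. Then $N\oplus L\cong N\oplus M$ implies $L\cong M$. More generally, if $K$ is a direct summand of a direct sum of finitely many copies of $N$ over $S$, then $K\oplus L\cong K\oplus M$ implies $L\cong M$.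
   Context: Rings are associative with unity and modules are unital. An algebra $S$ over a commutative ring $R$ is a ring with a unital ring homomorphism $R\to S$ whose image lies in the center of $S$; it is module-finite if it is finitely generated as an $R$-module. $E=\mathrm{End}_S(N)$ acts on the left of $N$, so $\mathrm{Hom}_S(M,N)$ is a left $E$-module. Localizations at a prime $\mathfrak p$ of $R$ are at the multiplicative set $R\setminus\mathfrak p$; elements of $F_{\mathfrak p}$ are regarded as maps $M_{\mathfrak p}\to N_{\mathfrak p}$ in the natural way, and an $m$-tuple in $F_{\mathfrak p}^{\oplus m}$ is regarded as an $S_{\mathfrak p}$-linear map $M_{\mathfrak p}\to N_{\mathfrak p}^{\oplus m}$. A split surjection is a linear map having a right inverse that is a linear map (a section). $j\text{-}\mathrm{Spec}(R)$ is the set of prime ideals of $R$ that are intersections of maximal ideals of $R$, with the subspace topology from the Zariski topology on $\mathrm{Spec}(R)$. $\mathrm{Supp}_R(N)=\{\mathfrak p\in\mathrm{Spec}(R):N_{\mathfrak p}\ne0\}$. A topological space is Noetherian if every descending chain of distinct closed sets has finite length. The Krull dimension of a space is the supremum of the lengths of chains of distinct closed irreducible subsets; for $\mathfrak p\in X$, $\dim_X(\mathfrak p)$ is the Krull dimension of the closure of $\{\mathfrak p\}$ in $X$. If $\dim_X(\mathfrak p)=\infty$, condition (3) at $\mathfrak p$ is read as: $F_{\mathfrak p}^{\oplus m}$ contains a split surjection $M_{\mathfrak p}\to N_{\mathfrak p}^{\oplus m}$ for arbitrarily large integers $m$. *)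

(* Defs.v *)
From HB Require Import structures.
From mathcomp Require Import all_boot all_order all_algebra.
From mathcomp Require Import generic_quotient.
From mathcomp Require Import all_classical topology.
From mathcomp Require Import ring.

Set Implicit Arguments.
Unset Strict Implicit.
Unset Printing Implicit Defensive.

Import GRing.Theory.
Local Open Scope ring_scope.
Local Open Scope quotient_scope.
Local Open Scope classical_set_scope.

(* Rings are [pzRingType]s, so that the zero ring is allowed: it does occur, as
   [End_S(0)] or as a localization. A right S-module is an [lmodType S^c]. *)

Section LinearMaps.
Context {A : pzRingType} {U V : lmodType A}.

HB.instance Definition _ := gen_eqMixin {linear U -> V}.
HB.instance Definition _ := gen_choiceMixin {linear U -> V}.

Lemma lin_ext (f g : {linear U -> V}) : f =1 g -> f = g.
Proof.
move=> /funext fg; case: f fg => f [[f1] [f2]]; case: g => g [[g1] [g2]] /= fg.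
by subst g; rewrite (Prop_irrelevance f1 g1) (Prop_irrelevance f2 g2).
Qed.

Definition lin_zero (x : U) : V := 0.
Definition lin_opp (f : {linear U -> V}) (x : U) : V := - f x.
Definition lin_add (f g : {linear U -> V}) (x : U) : V := f x + g x.

Fact lin_zero_is_linear : linear lin_zero.
Proof. by move=> a x y; rewrite /lin_zero scaler0 addr0. Qed.
HB.instance Definition _ := GRing.isLinear.Build A U V *:%R lin_zero
  lin_zero_is_linear.

Fact lin_opp_is_linear f : linear (lin_opp f).
Proof. by move=> a x y; rewrite /lin_opp linearP opprD scalerN. Qed.
HB.instance Definition _ f := GRing.isLinear.Build A U V *:%R (lin_opp f)
  (lin_opp_is_linear f).

Fact lin_add_is_linear f g : linear (lin_add f g).
Proof. by move=> a x y; rewrite /lin_add !linearP scalerDr addrACA. Qed.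
HB.instance Definition _ f g := GRing.isLinear.Build A U V *:%R (lin_add f g)
  (lin_add_is_linear f g).

Let add (f g : {linear U -> V}) : {linear U -> V} := lin_add f g.
Let opp (f : {linear U -> V}) : {linear U -> V} := lin_opp f.
Let zero : {linear U -> V} := lin_zero.

Fact lin_addA : associative add.
Proof. by move=> f g h; apply/lin_ext => x; apply: addrA. Qed.
Fact lin_addC : commutative add.
Proof. by move=> f g; apply/lin_ext => x; apply: addrC. Qed.
Fact lin_add0 : left_id zero add.
Proof. by move=> f; apply/lin_ext => x; apply: add0r. Qed.
Fact lin_addN : left_inverse zero opp add.
Proof. by move=> f; apply/lin_ext => x; apply: addNr. Qed.

HB.instance Definition _ := GRing.isZmodule.Build {linear U -> V}
  lin_addA lin_addC lin_add0 lin_addN.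

Lemma lin_addE (f g : {linear U -> V}) x : (f + g) x = f x + g x.
Proof. by []. Qed.

End LinearMaps.

(* The ring End_A(V): composition is the product, so Endo V acts on the left. *)
Definition Endo {A : pzRingType} (V : lmodType A) : Type := {linear V -> V}.

Section Endomorphisms.
Context {A : pzRingType} (V : lmodType A).

HB.instance Definition _ := GRing.Zmodule.on (Endo V).

Definition end_one : Endo V := (idfun : {linear V -> V}).
Definition end_mul (f g : Endo V) : Endo V :=
  ((f : {linear V -> V}) \o (g : {linear V -> V}) : {linear V -> V}).

Fact end_mulA : associative end_mul.
Proof. by move=> f g h; apply/lin_ext. Qed.
Fact end_mul1 : left_id end_one end_mul.
Proof. by move=> f; apply/lin_ext. Qed.
Fact end_1mul : right_id end_one end_mul.
Proof. by move=> f; apply/lin_ext. Qed.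
Fact end_mulDl : left_distributive end_mul +%R.
Proof. by move=> f g h; apply/lin_ext. Qed.
Fact end_mulDr : right_distributive end_mul +%R.
Proof. by move=> f g h; apply/lin_ext => x; rewrite lin_addE /= linearD. Qed.

HB.instance Definition _ := GRing.Zmodule_isPzRing.Build (Endo V)
  end_mulA end_mul1 end_1mul end_mulDl end_mulDr.

End Endomorphisms.

Section HomEndModule.
Context {A : pzRingType} {U V : lmodType A}.

Definition lin_scale (e : Endo V) (f : {linear U -> V}) : {linear U -> V} :=
  (e : {linear V -> V}) \o f.

Fact lin_scaleA e e' f : lin_scale e (lin_scale e' f) = lin_scale (e * e') f.
Proof. exact/lin_ext. Qed.
Fact lin_scale1 : left_id 1 lin_scale.
Proof. by move=> f; apply/lin_ext. Qed.
Fact lin_scaleDr : right_distributive lin_scale +%R.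
Proof. by move=> e f g; apply/lin_ext => x; rewrite lin_addE /= linearD. Qed.
Fact lin_scaleDl f : {morph lin_scale^~ f : e e' / e + e'}.
Proof. by move=> e e'; apply/lin_ext. Qed.

HB.instance Definition _ := GRing.Zmodule_isLmodule.Build (Endo V)
  {linear U -> V} lin_scaleA lin_scale1 lin_scaleDr lin_scaleDl.

End HomEndModule.

(* The library's [algType] would exclude the zero ring, hence this record. *)
Record algebra (R : comPzRingType) (S : pzRingType) := Algebra {
  alg_map :> {rmorphism R -> S};
  alg_mapC : forall r s, alg_map r * s = s * alg_map r }.

Definition alg_mod {R : comPzRingType} {S : pzRingType} (alpha : algebra R S) :
  Type := S.

Section AlgMod.
Context {R : comPzRingType} {S : pzRingType} (alpha : algebra R S).

HB.instance Definition _ := GRing.Zmodule.on (alg_mod alpha).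

Definition alg_scale (r : R) (x : alg_mod alpha) : alg_mod alpha :=
  alpha r * (x : S).

Fact alg_scaleA r r' x : alg_scale r (alg_scale r' x) = alg_scale (r * r') x.
Proof. by rewrite /alg_scale rmorphM mulrA. Qed.
Fact alg_scale1 : left_id 1 alg_scale.
Proof. by move=> x; rewrite /alg_scale rmorph1 mul1r. Qed.
Fact alg_scaleDr : right_distributive alg_scale +%R.
Proof. by move=> r x y; apply: mulrDr. Qed.
Fact alg_scaleDl x : {morph alg_scale^~ x : r r' / r + r'}.
Proof. by move=> r r'; rewrite /alg_scale rmorphD; apply: mulrDl. Qed.

HB.instance Definition _ := GRing.Zmodule_isLmodule.Build R (alg_mod alpha)
  alg_scaleA alg_scale1 alg_scaleDr alg_scaleDl.

End AlgMod.

Definition rmod {R : comPzRingType} {S : pzRingType} (alpha : algebra R S)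
  (M : lmodType S^c) : Type := M.

Section RMod.
Context {R : comPzRingType} {S : pzRingType} (alpha : algebra R S).
Context (M : lmodType S^c).

HB.instance Definition _ := GRing.Zmodule.on (rmod alpha M).

Definition rmod_scale (r : R) (x : rmod alpha M) : rmod alpha M :=
  (alpha r : S^c) *: (x : M).

Fact rmod_scaleA r r' x :
  rmod_scale r (rmod_scale r' x) = rmod_scale (r * r') x.
Proof. by rewrite /rmod_scale scalerA mulrC rmorphM. Qed.
Fact rmod_scale1 : left_id 1 rmod_scale.
Proof. by move=> x; rewrite /rmod_scale rmorph1; apply: scale1r. Qed.
Fact rmod_scaleDr : right_distributive rmod_scale +%R.
Proof. by move=> r x y; apply: scalerDr. Qed.
Fact rmod_scaleDl x : {morph rmod_scale^~ x : r r' / r + r'}.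
Proof. by move=> r r'; rewrite /rmod_scale rmorphD; apply: scalerDl. Qed.

HB.instance Definition _ := GRing.Zmodule_isLmodule.Build R (rmod alpha M)
  rmod_scaleA rmod_scale1 rmod_scaleDr rmod_scaleDl.

End RMod.

(* End_S(N) as an R-algebra: r acts by x |-> x (alpha r). *)
Section EndAlgebra.
Context {R : comPzRingType} {S : pzRingType} (alpha : algebra R S).
Context (N : lmodType S^c).

Definition homothety (r : R) (x : N) : N := (alpha r : S^c) *: x.

Fact homothety_is_linear r : linear (homothety r).
Proof.
move=> s x y; rewrite /homothety scalerDr !scalerA; congr (_ *: _ + _).
exact: esym (alg_mapC alpha r s).
Qed.
HB.instance Definition _ r := GRing.isLinear.Build S^c N N *:%R (homothety r)
  (homothety_is_linear r).

Definition end_alg_map (r : R) : Endo N := (homothety r : {linear N -> N}).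

Fact end_alg_map_is_zmod : zmod_morphism end_alg_map.
Proof.
move=> r r'; apply/lin_ext => x; rewrite /= /homothety rmorphB.
exact: scalerBl.
Qed.
Fact end_alg_map_is_monoid : monoid_morphism end_alg_map.
Proof.
split; first by apply/lin_ext => x; rewrite /= /homothety rmorph1; apply: scale1r.
move=> r r'; apply/lin_ext => x; rewrite /= /homothety scalerA mulrC rmorphM.
by [].
Qed.
HB.instance Definition _ := GRing.isZmodMorphism.Build R (Endo N) end_alg_map
  end_alg_map_is_zmod.
HB.instance Definition _ := GRing.isMonoidMorphism.Build R (Endo N) end_alg_map
  end_alg_map_is_monoid.

Fact end_alg_mapC r (f : Endo N) : end_alg_map r * f = f * end_alg_map r.
Proof. by apply/lin_ext => x; rewrite /= /homothety linearZ. Qed.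

Definition end_alg : algebra R (Endo N) :=
  @Algebra R (Endo N) end_alg_map end_alg_mapC.

End EndAlgebra.

(* Hom_S(M, N) as an R-module, through R -> End_S(N). *)
Definition hom_mod {R : comPzRingType} {S : pzRingType} (alpha : algebra R S)
  (M N : lmodType S^c) : Type := {linear M -> N}.

Section HomMod.
Context {R : comPzRingType} {S : pzRingType} (alpha : algebra R S).
Context (M N : lmodType S^c).

HB.instance Definition _ := GRing.Zmodule.on (hom_mod alpha M N).

Definition hom_scale (r : R) (f : hom_mod alpha M N) : hom_mod alpha M N :=
  end_alg alpha N r *: (f : {linear M -> N}).

Fact hom_scaleA r r' f : hom_scale r (hom_scale r' f) = hom_scale (r * r') f.
Proof. by rewrite /hom_scale scalerA rmorphM. Qed.
Fact hom_scale1 : left_id 1 hom_scale.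
Proof. by move=> f; rewrite /hom_scale rmorph1; apply: scale1r. Qed.
Fact hom_scaleDr : right_distributive hom_scale +%R.
Proof. by move=> r f g; apply: scalerDr. Qed.
Fact hom_scaleDl f : {morph hom_scale^~ f : r r' / r + r'}.
Proof. by move=> r r'; rewrite /hom_scale rmorphD; apply: scalerDl. Qed.

HB.instance Definition _ := GRing.Zmodule_isLmodule.Build R (hom_mod alpha M N)
  hom_scaleA hom_scale1 hom_scaleDr hom_scaleDl.

End HomMod.

Section Modules.
Context {A : pzRingType}.

(* Only meaningful when [F] is a submodule, which is not required here. *)
Definition finitely_generated_sub (V : lmodType A) (F : {pred V}) : Prop :=
  exists (n : nat) (v : 'I_n -> V), (forall i, v i \in F) /\
    forall x, x \in F -> exists c : 'I_n -> A, x = \sum_i c i *: v i.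

Definition finitely_generated (V : lmodType A) : Prop :=
  finitely_generated_sub (predT : {pred V}).

(* A^m -> A^n -> V -> 0 is exact *)
Definition finitely_presented (V : lmodType A) : Prop :=
  exists (m n : nat) (u : {linear 'rV[A]_m -> 'rV[A]_n})
    (v : {linear 'rV[A]_n -> V}),
    (forall x, exists y, v y = x) /\
    (forall y, v y = 0 <-> exists z, u z = y).

Definition isomorphic (U V : lmodType A) : Prop :=
  exists f : {linear U -> V}, bijective f.

Definition summand_of_copies (U V : lmodType A) : Prop :=
  exists (n : nat) (W : lmodType A),
    isomorphic (U * W)%type {ffun 'I_n -> V}.

Definition split_surjection (U V : lmodType A) (f : {linear U -> V}) : Prop :=
  exists g : {linear V -> U}, cancel g f.

End Modules.

Definition module_finite {R : comPzRingType} {S : pzRingType}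
  (alpha : algebra R S) : Prop := finitely_generated (alg_mod alpha).

Section Ideals.
Context {R : comPzRingType}.
Implicit Types I m : {pred R}.

Definition ideal I : Prop :=
  0 \in I /\ forall a, {in I &, forall u v, a * u + v \in I}.

Definition prime_ideal I : Prop :=
  [/\ ideal I, 1 \notin I & forall u v, u * v \in I -> (u \in I) || (v \in I)].

Definition maximal_ideal m : Prop :=
  [/\ ideal m, 1 \notin m &
      forall I, ideal I -> 1 \notin I -> {subset m <= I} -> I =i m].

End Ideals.

(* [R -> bool] rather than [{pred R}] for the sake of universe levels *)
Record Spec (R : comPzRingType) := PrimeSpec {
  spec_ideal : R -> bool;
  spec_prime : prime_ideal (spec_ideal : {pred R}) }.

Coercion spec_pred (R : comPzRingType) (p : Spec R) : {pred R} := spec_ideal p.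

HB.instance Definition _ (R : comPzRingType) := gen_eqMixin (Spec R).
HB.instance Definition _ (R : comPzRingType) := gen_choiceMixin (Spec R).

Section Zariski.
Context {R : comPzRingType}.

Definition vanishing (T : set R) : set (Spec R) :=
  [set p : Spec R | forall f, T f -> f \in p].

Definition zariski_open (U : set (Spec R)) : Prop :=
  exists T : set R, U = ~` vanishing T.

Fact zariski_openT : zariski_open setT.
Proof.
exists setT; apply/seteqP; split=> // p _ /= Tp.
by case: (spec_prime p) => _ /negP + _; apply; apply: Tp.
Qed.

Fact zariski_openI : setI_closed zariski_open.
Proof.
move=> _ _ [T1 ->] [T2 ->].
exists [set h | exists f g, [/\ T1 f, T2 g & h = f * g]].
rewrite -setCU; congr (~` _); apply/seteqP; split=> p /=.
  case: (spec_prime p) => -[p0 pM] _ _ [] Tp _ [f [g [Tf Tg ->]]].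
    by rewrite mulrC -[_ * _]addr0 pM // Tp.
  by rewrite -[_ * _]addr0 pM // Tp.
move=> TTp; apply: contrapT => /not_orP[/existsNP[f /not_implyP[Tf pf]]].
move=> /existsNP[g /not_implyP[Tg pg]].
case: (spec_prime p) => _ _ /(_ f g (TTp _ _))/orP[|//|//].
by exists f, g.
Qed.

Fact zariski_open_bigU (I : Type) (f : I -> set (Spec R)) :
  (forall i, zariski_open (f i)) -> zariski_open (\bigcup_i f i).
Proof.
move=> fo; pose T i := projT1 (cid (fo i)).
have fT i : f i = ~` vanishing (T i) by rewrite /T; case: cid.
exists (\bigcup_i T i); rewrite [RHS](_ : _ = ~` \bigcap_i vanishing (T i)).
  by rewrite setC_bigcap; apply: eq_bigcupr => i _; exact: fT.
congr (~` _); apply/seteqP; split=> p /= Tp.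
  by move=> i _ g Tg; apply: Tp; exists i.
by move=> g [i _ Tg]; apply: (Tp i).
Qed.

HB.instance Definition _ := isOpenTopological.Build (Spec R)
  zariski_openT zariski_openI zariski_open_bigU.

Definition jSpec : set (Spec R) :=
  [set p : Spec R | exists Ms : set (R -> bool), (forall m, Ms m -> maximal_ideal m) /\
     forall x, x \in p <-> forall m, Ms m -> m x].

End Zariski.
Arguments jSpec R : clear implicits.

Definition noetherian_space (T : topologicalType) : Prop :=
  ~ exists C : nat -> set T,
      (forall n, closed (C n)) /\ (forall n, C n.+1 `<` C n).

Definition irreducible_set (T : topologicalType) (Z : set T) : Prop :=
  Z !=set0 /\ forall A B : set T, closed A -> closed B ->
    Z `<=` A `|` B -> Z `<=` A \/ Z `<=` B.

Definition has_irr_chain (T : topologicalType) (n : nat) : Prop :=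
  exists C : 'I_n.+1 -> set T,
    (forall i, closed (C i) /\ irreducible_set (C i)) /\
    (forall i j : 'I_n.+1, (i < j)%N -> C i `<` C j).

(* The dimension is a supremum that may be infinite, so it is given by the two
   relations [krull_dim_is] and [krull_dim_infinite]; a chain indexed by
   ['I_n.+1] has length n. *)
Definition krull_dim_is (T : topologicalType) (d : nat) : Prop :=
  has_irr_chain T d /\ forall n, has_irr_chain T n -> (n <= d)%N.

Definition krull_dim_infinite (T : topologicalType) : Prop :=
  forall d, exists2 n, (d <= n)%N & has_irr_chain T n.

Definition denom {R : comPzRingType} (p : Spec R) : Type :=
  {s : R | s \notin p}.

Section Denominators.
Context {R : comPzRingType} (p : Spec R).

HB.instance Definition _ := Choice.on (denom p).

Fact denom_one_proof : 1 \notin p.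
Proof. by case: (spec_prime p). Qed.
Definition denom_one : denom p := exist _ 1 denom_one_proof.

Fact denom_mul_proof (s t : denom p) : sval s * sval t \notin p.
Proof.
case: s t => [s ps] [t pt] /=; apply/negP => pst.
by case: (spec_prime p) => _ _ /(_ _ _ pst); rewrite (negPf ps) (negPf pt).
Qed.
Definition denom_mul (s t : denom p) : denom p :=
  exist _ (sval s * sval t) (denom_mul_proof s t).

End Denominators.

(* The elements x / s of V_p, with s outside p. *)
Section Localization.
Context {R : comPzRingType} (p : Spec R) (V : lmodType R).
Implicit Types (x y : V) (s t u : denom p).

Definition loc_rel : rel (V * denom p) := fun a b =>
  `[< exists u : denom p,
        (sval u * sval b.2) *: a.1 = (sval u * sval a.2) *: b.1 >].

Fact loc_rel_refl : reflexive loc_rel.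
Proof. by move=> a; apply/asboolP; exists (denom_one p). Qed.

Fact loc_rel_sym : symmetric loc_rel.
Proof. by move=> a b; apply/asboolP/asboolP => -[u]; exists u. Qed.

Fact loc_rel_trans : transitive loc_rel.
Proof.
move=> [y t] [x s] [z r] /asboolP[/= u xy] /asboolP[/= v yz].
apply/asboolP; exists (denom_mul t (denom_mul u v)) => /=.
transitivity ((sval v * sval r) *: ((sval u * sval t) *: x)).
  by rewrite scalerA; congr (_ *: _); ring.
rewrite xy; transitivity ((sval u * sval s) *: ((sval v * sval r) *: y)).
  by rewrite !scalerA; congr (_ *: _); ring.
by rewrite yz !scalerA; congr (_ *: _); ring.
Qed.

Canonical loc_equiv := EquivRel loc_rel loc_rel_refl loc_rel_sym loc_rel_trans.

Definition Loc : Type := {eq_quot loc_rel}.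
HB.instance Definition _ : EqQuotient _ loc_rel Loc := EqQuotient.on Loc.
HB.instance Definition _ := Choice.on Loc.

Definition frac x s : Loc := \pi_Loc (x, s).

Lemma fracP x s y t : frac x s = frac y t <->
  exists u, (sval u * sval t) *: x = (sval u * sval s) *: y.
Proof.
split; first by move=> /eqquotP/asboolP.
by move=> h; apply/eqquotP/asboolP.
Qed.

Lemma fracW (z : Loc) : exists x s, z = frac x s.
Proof. by exists (repr z).1, (repr z).2; rewrite /frac -surjective_pairing reprK. Qed.

Lemma frac_scale u x s : frac (sval u *: x) (denom_mul u s) = frac x s.
Proof.
by apply/fracP; exists (denom_one p); rewrite /= !mul1r scalerA mulrC.
Qed.

(* A chosen numerator and denominator of a fraction. *)
Definition numl (a : Loc) : V := (repr a).1.
Definition denl (a : Loc) : denom p := (repr a).2.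

Lemma numdenP x s : exists u,
  (sval u * sval s) *: numl (frac x s) = (sval u * sval (denl (frac x s))) *: x.
Proof. by apply/fracP; rewrite /frac -surjective_pairing reprK. Qed.

Definition loc_add (a b : Loc) : Loc :=
  frac (sval (denl b) *: numl a + sval (denl a) *: numl b)
       (denom_mul (denl a) (denl b)).
Definition loc_opp (a : Loc) : Loc := frac (- numl a) (denl a).
Definition loc_zero : Loc := frac 0 (denom_one p).

Lemma loc_addE x s y t :
  loc_add (frac x s) (frac y t) =
  frac (sval t *: x + sval s *: y) (denom_mul s t).
Proof.
rewrite /loc_add; have [u] := numdenP x s; have [v] := numdenP y t.
move: (numl _) (denl _) => y' t' yE; move: (numl _) (denl _) => x' s' xE.
apply/fracP; exists (denom_mul u v) => /=; rewrite !scalerDr !scalerA.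
congr (_ + _).
  transitivity ((sval v * sval t * sval t') *: ((sval u * sval s) *: x')).
    by rewrite scalerA; congr (_ *: _); ring.
  by rewrite xE scalerA; congr (_ *: _); ring.
transitivity ((sval u * sval s * sval s') *: ((sval v * sval t) *: y')).
  by rewrite scalerA; congr (_ *: _); ring.
by rewrite yE scalerA; congr (_ *: _); ring.
Qed.

Lemma loc_oppE x s : loc_opp (frac x s) = frac (- x) s.
Proof.
rewrite /loc_opp; have [u] := numdenP x s.
move: (numl _) (denl _) => x' s' xE.
by apply/fracP; exists u; rewrite !scalerN xE.
Qed.

Fact loc_addA : associative loc_add.
Proof.
move=> a b c; have [x [s ->]] := fracW a; have [y [t ->]] := fracW b.
have [z [r ->]] := fracW c; rewrite !loc_addE.
apply/fracP; exists (denom_one p) => /=; rewrite !scalerDr !scalerA addrA.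
by congr (_ + _ + _); congr (_ *: _); ring.
Qed.

Fact loc_addC : commutative loc_add.
Proof.
move=> a b; have [x [s ->]] := fracW a; have [y [t ->]] := fracW b.
rewrite !loc_addE; apply/fracP; exists (denom_one p) => /=.
by rewrite addrC [sval s * _]mulrC.
Qed.

Fact loc_add0 : left_id loc_zero loc_add.
Proof.
move=> a; have [x [s ->]] := fracW a; rewrite loc_addE scaler0 add0r scale1r.
by apply/fracP; exists (denom_one p); rewrite /= !mul1r.
Qed.

Fact loc_addN : left_inverse loc_zero loc_opp loc_add.
Proof.
move=> a; have [x [s ->]] := fracW a; rewrite loc_oppE loc_addE scalerN addNr.
by apply/fracP; exists (denom_one p) => /=; rewrite !scaler0.
Qed.

HB.instance Definition _ := GRing.isZmodule.Build Loc
  loc_addA loc_addC loc_add0 loc_addN.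

Lemma frac_add x s y t :
  frac x s + frac y t = frac (sval t *: x + sval s *: y) (denom_mul s t).
Proof. exact: loc_addE. Qed.

Lemma frac_addl x y s : frac x s + frac y s = frac (x + y) s.
Proof. by rewrite frac_add -scalerDr frac_scale. Qed.

(* For a submodule F of V, the submodule F_p of V_p. *)
Definition loc_sub (F : {pred V}) : set Loc :=
  [set a | exists x s, x \in F /\ a = frac x s].

End Localization.

Definition locRing {R : comPzRingType} {S : pzRingType} (p : Spec R)
  (alpha : algebra R S) : Type := Loc p (alg_mod alpha).

Section LocRing.
Context {R : comPzRingType} {S : pzRingType} (p : Spec R) (alpha : algebra R S).
Implicit Types (x y : S) (s t u : denom p).

HB.instance Definition _ := GRing.Zmodule.on (locRing p alpha).

Definition sfrac x s : locRing p alpha := frac (x : alg_mod alpha) s.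

Lemma alg_scaleE r x : r *: (x : alg_mod alpha) = alpha r * x.
Proof. by []. Qed.

Lemma sfracP x s y t : sfrac x s = sfrac y t <->
  exists u, alpha (sval u * sval t) * x = alpha (sval u * sval s) * y.
Proof. exact: fracP. Qed.

Lemma sfracW (a : locRing p alpha) : exists x s, a = sfrac x s.
Proof. exact: (@fracW R p (alg_mod alpha) a). Qed.

Lemma sfrac_add x s y t :
  sfrac x s + sfrac y t =
  sfrac (alpha (sval t) * x + alpha (sval s) * y) (denom_mul s t).
Proof. exact: frac_add. Qed.

Definition locRing_one : locRing p alpha := sfrac 1 (denom_one p).
Definition locRing_mul (a b : locRing p alpha) : locRing p alpha :=
  sfrac ((numl a : S) * (numl b : S)) (denom_mul (denl a) (denl b)).

Lemma snumdenP x s : exists u,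
  alpha (sval u * sval s) * (numl (sfrac x s) : S) =
  alpha (sval u * sval (denl (sfrac x s))) * x.
Proof. exact: (@numdenP R p (alg_mod alpha) x s). Qed.

Lemma locRing_mulE x s y t :
  locRing_mul (sfrac x s) (sfrac y t) = sfrac (x * y) (denom_mul s t).
Proof.
rewrite /locRing_mul; have [u] := snumdenP x s; have [v] := snumdenP y t.
move: (numl (sfrac y t) : S) (denl _) => y' t' yE.
move: (numl (sfrac x s) : S) (denl _) => x' s' xE.
apply/sfracP; exists (denom_mul u v) => /=.
transitivity ((alpha (sval u * sval s) * x') * (alpha (sval v * sval t) * y')).
  rewrite -!mulrA [x' * (alpha _ * _)]mulrA -alg_mapC !mulrA -!rmorphM.
  by congr (alpha _ * _ * _); ring.
rewrite xE yE -!mulrA [x * (alpha _ * _)]mulrA -alg_mapC !mulrA -!rmorphM.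
by congr (alpha _ * _ * _); ring.
Qed.

Fact locRing_mulA : associative locRing_mul.
Proof.
move=> a b c; have [x [s ->]] := sfracW a; have [y [t ->]] := sfracW b.
have [z [r ->]] := sfracW c; rewrite !locRing_mulE.
by apply/sfracP; exists (denom_one p); rewrite /= !mulrA.
Qed.

Fact locRing_mul1 : left_id locRing_one locRing_mul.
Proof.
move=> a; have [x [s ->]] := sfracW a; rewrite locRing_mulE mul1r.
by apply/sfracP; exists (denom_one p); rewrite /= !mul1r.
Qed.

Fact locRing_1mul : right_id locRing_one locRing_mul.
Proof.
move=> a; have [x [s ->]] := sfracW a; rewrite locRing_mulE mulr1.
by apply/sfracP; exists (denom_one p); rewrite /= !mulr1.
Qed.

Fact locRing_mulDl : left_distributive locRing_mul +%R.
Proof.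
move=> a b c; have [x [s ->]] := sfracW a; have [y [t ->]] := sfracW b.
have [z [r ->]] := sfracW c; rewrite !(sfrac_add, locRing_mulE).
apply/sfracP; exists (denom_one p) => /=; rewrite !(mulrDl, mulrDr) !mulrA.
by rewrite -!rmorphM; congr (alpha _ * _ * _ + alpha _ * _ * _); ring.
Qed.

Fact locRing_mulDr : right_distributive locRing_mul +%R.
Proof.
move=> a b c; have [x [s ->]] := sfracW a; have [y [t ->]] := sfracW b.
have [z [r ->]] := sfracW c; rewrite !(sfrac_add, locRing_mulE).
apply/sfracP; exists (denom_one p) => /=; rewrite !(mulrDl, mulrDr) !mulrA.
rewrite -!(mulrA _ x) -!(alg_mapC alpha _ x) !mulrA.
by rewrite -!rmorphM; congr (alpha _ * _ * _ + alpha _ * _ * _); ring.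
Qed.

HB.instance Definition _ := GRing.Zmodule_isPzRing.Build (locRing p alpha)
  locRing_mulA locRing_mul1 locRing_1mul locRing_mulDl locRing_mulDr.

Lemma sfrac_mul x s y t :
  sfrac x s * sfrac y t = sfrac (x * y) (denom_mul s t).
Proof. exact: locRing_mulE. Qed.

End LocRing.

Definition locMod {R : comPzRingType} {S : pzRingType} (p : Spec R)
  (alpha : algebra R S) (M : lmodType S^c) : Type := Loc p (rmod alpha M).

(* M_p is a right S_p-module: (x / s) (a / t) = (x a) / (s t). *)
Section LocMod.
Context {R : comPzRingType} {S : pzRingType} (p : Spec R) (alpha : algebra R S).
Context (M : lmodType S^c).
Implicit Types (x y : M) (a b : S) (s t u : denom p).

HB.instance Definition _ := GRing.Zmodule.on (locMod p alpha M).

Definition mfrac x s : locMod p alpha M := frac (x : rmod alpha M) s.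

Lemma rmod_scaleE r x : r *: (x : rmod alpha M) = (alpha r : S^c) *: x.
Proof. by []. Qed.

Lemma mfracP x s y t : mfrac x s = mfrac y t <->
  exists u, (alpha (sval u * sval t) : S^c) *: x =
            (alpha (sval u * sval s) : S^c) *: y.
Proof. exact: fracP. Qed.

Lemma mfracW (z : locMod p alpha M) : exists x s, z = mfrac x s.
Proof. exact: (@fracW R p (rmod alpha M) z). Qed.

Lemma mfrac_add x s y t :
  mfrac x s + mfrac y t =
  mfrac ((alpha (sval t) : S^c) *: x + (alpha (sval s) : S^c) *: y)
        (denom_mul s t).
Proof. exact: frac_add. Qed.

Definition locMod_scale (c : (locRing p alpha)^c) (z : locMod p alpha M) :
    locMod p alpha M :=
  mfrac ((numl (c : locRing p alpha) : S^c) *: (numl z : M))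
        (denom_mul (denl (c : locRing p alpha)) (denl z)).

Lemma mnumdenP x s : exists u,
  (alpha (sval u * sval s) : S^c) *: (numl (mfrac x s) : M) =
  (alpha (sval u * sval (denl (mfrac x s))) : S^c) *: x.
Proof. exact: (@numdenP R p (rmod alpha M) x s). Qed.

Lemma scale_convM a b x :
  ((a * b : S) : S^c) *: x = (b : S^c) *: ((a : S^c) *: x).
Proof. by rewrite scalerA. Qed.

Lemma scale_algC a r x :
  (a : S^c) *: ((alpha r : S^c) *: x) = (alpha r : S^c) *: ((a : S^c) *: x).
Proof. by rewrite -!scale_convM alg_mapC. Qed.

Lemma locMod_scaleE a t x s :
  locMod_scale (sfrac alpha a t) (mfrac x s) =
  mfrac ((a : S^c) *: x) (denom_mul t s).
Proof.
rewrite /locMod_scale; have [u] := mnumdenP x s.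
have [v] := snumdenP alpha a t.
move: (numl (sfrac alpha a t) : S) (denl _) => a' t' aE.
move: (numl (mfrac x s) : M) (denl _) => x' s' xE.
apply/mfracP; exists (denom_mul u v) => /=.
transitivity (((alpha (sval v * sval t) * a' : S) : S^c) *:
              ((alpha (sval u * sval s) : S^c) *: x')).
  rewrite -!scale_convM -alg_mapC; congr (_ *: _).
  by rewrite [RHS]mulrA -rmorphM; congr (alpha _ * _ : S); ring.
rewrite aE xE -!scale_convM -alg_mapC; congr (_ *: _).
by rewrite [LHS]mulrA -rmorphM; congr (alpha _ * _ : S); ring.
Qed.

Fact locMod_scaleA c d z :
  locMod_scale c (locMod_scale d z) = locMod_scale (c * d) z.
Proof.
have [a [s ->]] := @sfracW R S p alpha c; have [b [t ->]] := @sfracW R S p alpha d.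
have [x [r ->]] := mfracW z.
transitivity
    (locMod_scale (sfrac alpha (b * a) (denom_mul t s)) (mfrac x r)); last first.
  by congr locMod_scale; exact/esym/sfrac_mul.
rewrite !locMod_scaleE scale_convM; apply/mfracP; exists (denom_one p) => /=.
by congr (_ *: _); congr (alpha _ : S); ring.
Qed.

Fact locMod_scale1 : left_id 1 locMod_scale.
Proof.
move=> z; have [x [s ->]] := mfracW z.
rewrite [LHS](locMod_scaleE 1 (denom_one p)) (scale1r (R := S^c)).
by apply/mfracP; exists (denom_one p) => /=; rewrite !mul1r.
Qed.

Fact locMod_scaleDr : right_distributive locMod_scale +%R.
Proof.
move=> c z z'; have [a [s ->]] := @sfracW R S p alpha c.
have [x [r ->]] := mfracW z; have [x' [r' ->]] := mfracW z'.
rewrite !(mfrac_add, locMod_scaleE) scalerDr !scale_algC.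
apply/mfracP; exists (denom_one p) => /=; rewrite !scalerDr -!scale_convM.
by rewrite -!mulrA -!rmorphM; congr (_ + _); congr (_ *: _); congr (_ * alpha _ : S); ring.
Qed.

Fact locMod_scaleDl z : {morph locMod_scale^~ z : c d / c + d}.
Proof.
move=> c d; have [a [s ->]] := @sfracW R S p alpha c.
have [b [t ->]] := @sfracW R S p alpha d; have [x [r ->]] := mfracW z.
transitivity (locMod_scale (sfrac alpha
    (alpha (sval t) * a + alpha (sval s) * b) (denom_mul s t)) (mfrac x r)).
  by congr locMod_scale; exact: sfrac_add.
rewrite !locMod_scaleE mfrac_add.
apply/mfracP; exists (denom_one p) => /=.
rewrite (scalerDl (R := S^c)) !scalerDr -!scale_convM.
rewrite (alg_mapC alpha _ a) (alg_mapC alpha _ b) -!mulrA -!rmorphM.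
by congr (_ + _); congr (_ *: _); congr (_ * alpha _ : S); ring.
Qed.

HB.instance Definition _ := GRing.Zmodule_isLmodule.Build (locRing p alpha)^c
  (locMod p alpha M) locMod_scaleA locMod_scale1 locMod_scaleDr locMod_scaleDl.

Lemma mfrac_scale a t x s :
  (sfrac alpha a t : (locRing p alpha)^c) *: mfrac x s =
  mfrac ((a : S^c) *: x) (denom_mul t s).
Proof. exact: locMod_scaleE. Qed.

End LocMod.

(* The natural map Hom_S(M, N)_p -> Hom_{S_p}(M_p, N_p),
   f / s |-> (x / t |-> f x / (s t)). *)
Section LocHom.
Context {R : comPzRingType} {S : pzRingType} (p : Spec R) (alpha : algebra R S).
Context {M N : lmodType S^c}.
Implicit Types (x y : M) (s t u : denom p) (f g : {linear M -> N}).

Definition loc_hom_fun (h : Loc p (hom_mod alpha M N)) (z : locMod p alpha M) :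
    locMod p alpha N :=
  mfrac alpha ((numl h : {linear M -> N}) (numl z : M))
    (denom_mul (denl h) (denl z)).

Lemma loc_hom_funE f s x t :
  loc_hom_fun (frac (f : hom_mod alpha M N) s) (mfrac alpha x t) =
  mfrac alpha (f x) (denom_mul s t).
Proof.
rewrite /loc_hom_fun; have [u] := mnumdenP alpha x t.
have [v] := numdenP (f : hom_mod alpha M N) s.
move: (numl (frac _ _)) (denl _) => g s' gE.
move: (numl (mfrac _ x t) : M) (denl _) => y t' yE.
have {}gE z : (alpha (sval v * sval s) : S^c) *: (g : {linear M -> N}) z =
              (alpha (sval v * sval s') : S^c) *: f z.
  exact: (congr1 (fun h : hom_mod alpha M N => (h : {linear M -> N}) z) gE).
apply/mfracP; exists (denom_mul u v) => /=.
transitivity ((alpha (sval v * sval s) : S^c) *: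
  (g : {linear M -> N}) ((alpha (sval u * sval t) : S^c) *: y)).
  rewrite linearZ -scale_convM -rmorphM; congr (_ *: _); congr (alpha _ : S); ring.
rewrite gE yE linearZ -scale_convM -rmorphM; congr (_ *: _); congr (alpha _ : S); ring.
Qed.

Fact loc_hom_fun_is_linear h : linear (loc_hom_fun h).
Proof.
move=> c z z'; have [f [s ->]] := fracW h.
have [a [t ->]] := @sfracW R S p alpha c.
have [x [r ->]] := mfracW z; have [y [r' ->]] := mfracW z'.
rewrite mfrac_scale mfrac_add !loc_hom_funE mfrac_scale mfrac_add linearD !linearZ.
apply/mfracP; exists (denom_one p) => /=; rewrite !scalerDr -!scale_convM.
rewrite -!mulrA -!rmorphM; congr (_ + _); congr (_ *: _).
  by congr (_ * alpha _ : S); ring.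
by congr (alpha _ : S); ring.
Qed.

HB.instance Definition _ h := GRing.isLinear.Build (locRing p alpha)^c
  (locMod p alpha M) (locMod p alpha N) *:%R (loc_hom_fun h)
  (loc_hom_fun_is_linear h).

Definition loc_hom (h : Loc p (hom_mod alpha M N)) :
  {linear locMod p alpha M -> locMod p alpha N} := loc_hom_fun h.

Definition loc_tuple_fun m (h : 'I_m -> Loc p (hom_mod alpha M N))
  (z : locMod p alpha M) : {ffun 'I_m -> locMod p alpha N} :=
  [ffun i => loc_hom (h i) z].

Fact loc_tuple_fun_is_linear m (h : 'I_m -> Loc p (hom_mod alpha M N)) :
  linear (loc_tuple_fun h).
Proof. by move=> c z z'; apply/ffunP => i; rewrite !ffunE linearP. Qed.

HB.instance Definition _ m h := GRing.isLinear.Build (locRing p alpha)^c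
  (locMod p alpha M) {ffun 'I_m -> locMod p alpha N} *:%R
  (@loc_tuple_fun m h) (loc_tuple_fun_is_linear h).

(* An m-tuple of elements of Hom_S(M, N)_p as a map M_p -> (N_p)^m. *)
Definition loc_tuple m (h : 'I_m -> Loc p (hom_mod alpha M N)) :
  {linear locMod p alpha M -> {ffun 'I_m -> locMod p alpha N}} :=
  loc_tuple_fun h.

(* (F_p)^m contains a split surjection M_p -> (N_p)^m. *)
Definition has_split_surjection (F : {pred {linear M -> N}}) (m : nat) : Prop :=
  exists h : 'I_m -> Loc p (hom_mod alpha M N),
    (forall i, loc_sub (F : {pred hom_mod alpha M N}) (h i)) /\
    split_surjection (loc_tuple h).

End LocHom.

Definition Supp {R : comPzRingType} {S : pzRingType} (alpha : algebra R S)
    (N : lmodType S^c) : set (Spec R) :=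
  [set p : Spec R | exists z : locMod p alpha N, z <> 0].

(* The space X of the theorem; its subspace topology is that of [set_type]. *)
Definition jSupp {R : comPzRingType} {S : pzRingType} (alpha : algebra R S)
    (N : lmodType S^c) : set (Spec R) := jSpec R `&` Supp alpha N.

(* The closure of {p} in X, with its subspace topology; its Krull dimension is
   dim_X(p). *)
Definition point_closure {T : topologicalType} (X : set T) (p : set_type X) :
    topologicalType :=
  set_type (closure [set p] : set (set_type X)).

(* Main.v *)
From HB Require Import structures.
Require Import Defs.
From mathcomp Require Import all_boot all_order all_algebra.
From mathcomp Require Import falgebra generic_quotient.
From mathcomp Require Import all_classical topology.
From mathcomp Require Import ring.

(* An isomorphism N + L ~ N + M exhibits L as the kernel of a split surjection
   (a, g) : N + M -> N, and L ~ M as soon as g + a f is a split surjection for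
   some f : M -> N. Let f_1, ..., f_n generate F and E = End_S(N). Such an f is
   found in F by an argument in the style of Swan and Eisenbud-Evans on the
   right E-module Q = E^(n+1) / W, where W is the set of the
   (g k, f_1 k, ..., f_n k), with k : N -> M. As (a, g) is a split surjection, Q
   is generated by y_0 = x_0 a and y_i = x_i, for i > 0, where the x_i are the
   images of the basis vectors. A split surjection in F_p^m makes Q_p generated
   by n + 1 - m elements. Then y_n, y_(n-1), ..., y_1 are in turn replaced with
   xi_i = y_i + sum_(j < i) y_j e_ij, chosen so that killing xi_i lowers by one
   the number of generators of the module at finitely many primes, namely at
   the minimal points of the loci where this number exceeds a given bound; the
   other points of X are controlled by their dimension. In the end the xi_i
   generate Q, and back substitution gives f. At a single prime, the choice of
   xi_i amounts to the fact that the finite-dimensional algebra E_p / p E_p has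
   stable range one.
   Right E-modules are left modules over A = E^c, and quotients are avoided by
   working modulo a submodule [P] of a module [Q]. *)

(** [L] and [M] need not be finitely generated, so neither Nakayama's lemma nor a count of
    generators makes sense for them; $Q$ is finitely generated over $E$, hence over $R$, and there
    both apply. The generator $y_0$ is $x_0a$ because the sought surjection has the form $g+af$. If
    $x_0$ equals $\sum_i y_ic_i$ modulo $W$, then for some $k$ the coordinates give $gk=1-ac_0$ and
    $f_ik=-c_i$. With $f=\sum_{i>0}b_if_i$, the equation $gk+afk=1$ follows from $\sum_i b_ic_i=0$
    and $b_0=1$. The $\xi_i$ provide such $b_i$: each involves $y_i$ with coefficient one and
    otherwise only earlier $y_j$, and $y_0$ is never replaced. The count comes out even: at $p$ at
    most $n-\dim_X(p)$ generators are needed at first, each of the $n$ steps lowers $n$ by one, and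
    a module that vanishes at all primes of $X$, hence at all maximal ideals containing the
    annihilator of $N$, is zero. Two obstacles shape the algebra at one prime: the residue field may
    be finite, so there is no generic scalar to choose, and a residue class lifts to $E$ only up to
    a nonzero scalar. *)

Set Implicit Arguments.
Unset Strict Implicit.
Unset Printing Implicit Defensive.

Import GRing.Theory.
Local Open Scope ring_scope.

(** * Stable range one for finite-dimensional algebras *)

Section ExtremalSubspaces.
Context {K : fieldType} {V : vectType K}.
Implicit Types (P : {vspace V} -> Prop) (U W : {vspace V}).

Lemma vspace_max P : (exists U, P U) ->
  exists2 U, P U & forall W, P W -> (U <= W)%VS -> (W <= U)%VS.
Proof.
move=> [U0 PU0]; pose D d := `[< exists2 U, P U & \dim U = d >].
have exD : exists d, D d by exists (\dim U0); apply/asboolP; exists U0.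
have Dle d : D d -> (d <= \dim {:V})%N.
  by move=> /asboolP[U _ <-]; apply/dimvS/subvf.
case: (ex_maxnP exD Dle) => d /asboolP[U PU Ud] dmax; exists U => // W PW UW.
have /eqP -> : U == W; last exact: subvv.
by rewrite eqEdim UW Ud dmax //; apply/asboolP; exists W.
Qed.

Lemma vspace_min P : (exists U, P U) ->
  exists2 U, P U & forall W, P W -> (W <= U)%VS -> (U <= W)%VS.
Proof.
move=> [U0 PU0]; pose D d := `[< exists2 U, P U & \dim U = d >].
have exD : exists d, D d by exists (\dim U0); apply/asboolP; exists U0.
case: (ex_minnP exD) => d /asboolP[U PU Ud] dmin; exists U => // W PW WU.
have /eqP -> : W == U; last exact: subvv.
by rewrite eqEdim WU Ud dmin //; apply/asboolP; exists W.
Qed.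

Lemma vspace_of (P : V -> Prop) : P 0 ->
  (forall a u v, P u -> P v -> P (a *: u + v)) ->
  exists U : {vspace V}, forall x, x \in U <-> P x.
Proof.
move=> P0 Plin.
have [|U PU Umax] := @vspace_max (fun U => forall x, x \in U -> P x).
  by exists 0%VS => x; rewrite memv0 => /eqP ->.
exists U => x; split=> [/PU//|Px].
have sub : (U <= U + <[x]>)%VS by apply: addvSl.
apply: (subvP (Umax _ _ sub)).
  move=> _ /memv_addP[u /PU Pu [_ /vlineP[c ->] ->]]; rewrite addrC.
  exact: Plin.
by apply: (subvP (addvSr U <[x]>)); apply: memv_line.
Qed.

End ExtremalSubspaces.

Section LeftIdeals.
Context {K : fieldType} {B : falgType K}.
Implicit Types (U I M P : {vspace B}) (a b x y : B).

Definition left_ideal U := forall y x, x \in U -> y * x \in U.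

Definition max_left_ideal M := [/\ left_ideal M, 1 \notin M &
  forall U, left_ideal U -> (M <= U)%VS -> 1 \notin U -> (U <= M)%VS].

Definition in_radical x := forall M, max_left_ideal M -> x \in M.

Lemma mem_amulr a x : reflect (exists y, x = y * a) (x \in limg (amulr a)).
Proof.
apply: (iffP memv_imgP) => [[y _ ->]|[y ->]]; first by exists y; rewrite lfunE.
by exists y; rewrite ?memvf // lfunE.
Qed.

Lemma mem_amull a x : reflect (exists y, x = a * y) (x \in limg (amull a)).
Proof.
apply: (iffP memv_imgP) => [[y _ ->]|[y ->]]; first by exists y; rewrite lfunE.
by exists y; rewrite ?memvf // lfunE.
Qed.

Lemma left_ideal_amulr a : left_ideal (limg (amulr a)).
Proof. by move=> y _ /mem_amulr[z ->]; apply/mem_amulr; exists (y * z); rewrite mulrA. Qed.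

Lemma left_idealD U I : left_ideal U -> left_ideal I -> left_ideal (U + I)%VS.
Proof.
move=> lU lI y _ /memv_addP[u Uu [v Iv ->]].
by rewrite mulrDr memv_add ?lU ?lI.
Qed.

Lemma left_idealI U I : left_ideal U -> left_ideal I -> left_ideal (U :&: I)%VS.
Proof.
by move=> lU lI y x; rewrite !memv_cap => /andP[Ux Ix]; rewrite lU ?lI.
Qed.

Lemma left_ideal1 U : left_ideal U -> 1 \in U -> forall x, x \in U.
Proof. by move=> lU U1 x; rewrite -[x]mulr1 lU. Qed.

Lemma max_left_ideal_add M U x : max_left_ideal M -> left_ideal U ->
  x \in U -> x \notin M -> forall z, exists2 u, u \in U & z - u \in M.
Proof.
case=> lM M1 Mmax lU Ux Mx z.
have UM1 : 1 \in (M + U)%VS.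
  apply: contraT => UM1; case/negP: Mx.
  apply: (subvP (Mmax _ (left_idealD lM lU) (addvSl _ _) UM1)).
  exact: (subvP (addvSr M U)).
have /memv_addP[m Mm [u Uu ->]] := left_ideal1 (left_idealD lM lU) UM1 z.
by exists u; rewrite ?addrK.
Qed.

Lemma max_left_ideal_ex a : (forall y, y * a != 1) ->
  exists2 M, max_left_ideal M & a \in M.
Proof.
move=> a1; pose P U := [/\ left_ideal U, a \in U & 1 \notin U].
have [|M [lM Ma M1] Mmax] := @vspace_max K B P.
  exists (limg (amulr a)); split; first exact: left_ideal_amulr.
    by apply/mem_amulr; exists 1; rewrite mul1r.
  by apply/mem_amulr => -[y] /esym/eqP; apply/negP.
exists M => //; split=> // U lU MU U1.
by apply: Mmax => //; split=> //; apply: (subvP MU).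
Qed.

(** If [x * y] is not in [M], neither is [y]; the [z] with [z * y] in [M] then form the annihilator
    of a nonzero element of the simple module $B/M$, which is a maximal left ideal and so contains
    [x]. *)
Lemma in_radicalMr x y : in_radical x -> in_radical (x * y).
Proof.
move=> Jx M maxM; apply: contraT => Mxy; case/negP: (Mxy).
have [lM M1 Mmax] := maxM; pose M' := (amulr y @^-1: M)%VS.
have M'P z : (z \in M') = (z * y \in M) by rewrite -memv_preim lfunE.
have lM' : left_ideal M' by move=> t z; rewrite !M'P -mulrA; apply: lM.
rewrite -M'P; apply: Jx; split=> //.
  by rewrite M'P mul1r; apply: contra Mxy; apply: lM.
move=> U lU M'U U1; apply/subvP => z Uz; rewrite M'P; apply: contraT => Mzy.
have [_ /mem_amulr[b ->]] :=
  max_left_ideal_add maxM (@left_ideal_amulr (z * y))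
    (introT (mem_amulr _ _) (ex_intro _ 1 (esym (mul1r _)))) Mzy y.
rewrite mulrA -{1}[y]mul1r -mulrBl -M'P => /(subvP M'U) U1b.
by case/negP: U1; rewrite -(subrK (b * z) 1) rpredD // lU.
Qed.

Lemma left_inverse_right x y : y * x = 1 -> exists z, x * z = 1.
Proof.
move=> yx; have : 1 \in limg (amull x); last by case/mem_amull => z ->; exists z.
suff k0 : lker (amull x) == 0%VS by rewrite (lker0_limgf k0) memvf.
apply/lker0P => u v; rewrite !lfunE /= => /(congr1 ( *%R y)).
by rewrite !mulrA yx !mul1r.
Qed.

Section RankIncrease.
Variables (J : {vspace B}) (a d : B) (I : {vspace B}).
Hypothesis JP : forall x, x \in J <-> in_radical x.
Hypotheses (lI : left_ideal I) (aI : 1 - d * a \in I).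
Hypothesis a_sing : forall y, y * a != 1.

(* With [a] in the maximal left ideal [M], left multiplication by [a] is not
   injective, hence not surjective, on the simple module [B / M]; a suitable
   [b] in [I] acts on [B / M] with image of rank one outside of that of [a]. *)
Lemma rank_increase : exists2 b, b \in I & forall c : K, c != 0 ->
  (\dim (limg (amull a) + J)%VS < \dim (limg (amull (a + c *: b)%R) + J)%VS)%N.
Proof.
have [M maxM Ma] := max_left_ideal_ex a_sing; have [lM M1 _] := maxM.
have JM : (J <= M)%VS by apply/subvP => x /JP/(_ M maxM).
(* [Pr U] says that [U] acts nontrivially on $B/M$. A minimal such [P] plays the part of a
   projective cover of $B/M$, without any lifting of idempotents. *)
pose Pr U := left_ideal U /\ exists r y, r \in U /\ r * y \notin M.
have [|P [lP [r [y [Pr_r ryM]]]] Pmin] := @vspace_min K B Pr.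
  exists fullv; split; first by move=> *; rewrite memvf.
  by exists 1, 1; rewrite memvf mulr1.
have {ryM y} [i Ii riM] : exists2 i, i \in I & r * i \notin M.
  (* As [a] lies in [M], this element is congruent to [y] modulo [M]. *)
  exists (y * (1 - d * a)); first exact: lI.
  apply: contra ryM => H; rewrite -[y]mulr1 -(subrK (d * a) 1) mulrDr mulrDr.
  by rewrite rpredD // !mulrA lM.
pose Pi := (amulr i @: P)%VS.
have PiP x : x \in Pi -> exists2 e, e \in P & x = e * i.
  by case/memv_imgP => e Pe ->; exists e; rewrite // lfunE.
have lPi : left_ideal Pi.
  move=> y x /PiP[e Pe ->]; rewrite mulrA; apply/memv_imgP; exists (y * e).
    exact: lP.
  by rewrite lfunE.
have riPi : r * i \in Pi by apply/memv_imgP; exists r; rewrite // lfunE.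
have PiM := max_left_ideal_add maxM lPi riPi riM.
have [v' v'P] : exists v', v' \notin (limg (amull a) + M)%VS.
  pose M' := (amull a @^-1: M)%VS.
  have lt : (\dim M < \dim M')%N.
    have MM' : (M <= M')%VS.
      by apply/subvP => z Mz; rewrite -memv_preim lfunE lM.
    rewrite ltn_neqAle dimvS // andbT; apply: contraNneq M1 => dMM'.
    have /eqP -> : M == M' by rewrite eqEdim MM' dMM' leqnn.
    by rewrite -memv_preim lfunE /= mulr1.
  have d1 := limg_ker_dim (amull a) fullv; rewrite capfv in d1.
  have d2 := limg_ker_dim (amull a) M'.
  have k1 : (M' :&: lker (amull a) = lker (amull a))%VS.
    apply/capv_idPr/subvP => z; rewrite memv_ker -memv_preim => /eqP ->.
    exact: mem0v.
  have k2 : (amull a @: M' = limg (amull a) :&: M)%VS.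
    apply/vspaceP => z; rewrite memv_cap; apply/memv_imgP/andP.
      case=> t; rewrite -memv_preim => Mt ->; split=> //.
      by apply: memv_img; apply: memvf.
    case=> /memv_imgP[t _ ->] Mt; exists t => //.
    by rewrite -memv_preim.
  rewrite k1 k2 in d2.
  have d3 := dimv_sum_cap (limg (amull a)) M.
  apply: contrapT => /forallNP full.
  have : (\dim {:B} <= \dim (limg (amull a) + M)%VS)%N.
    apply/dimvS/subvP => z _; apply/negPn/negP => nz.
    exact: (full z).
  rewrite -d1 leqNgt => /negP; apply.
  rewrite -(ltn_add2r (\dim (limg (amull a) :&: M)%VS)) d3 -addnA.
  by rewrite addnCA ltn_add2l d2.
have [x0 Px0 x0P] : exists2 x0, x0 \in P & 1 - x0 * i \in M.
  by have [_ /PiP[x0 Px0 ->]] := PiM 1; exists x0.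
have [eta Peta etaP] : exists2 e, e \in P & v' - e * i \in M.
  by have [_ /PiP[e Pe ->]] := PiM v'; exists e.
have {v' v'P etaP} etaM : eta * i \notin (limg (amull a) + M)%VS.
  apply: contra v'P => H; rewrite -(subrK (eta * i) v') rpredD //.
  exact: (subvP (addvSr _ _)).
exists (eta * i) => [|c c0]; first exact: lI.
(* The choice of [del] gives $a=a'(1-x_0i)-\mathrm{del}\,i$. Hence $aB$ lies in $a'B+J$ once [del]
   is shown to be in the radical. *)
set b := c *: (eta * i); set a' := a + b.
pose del := c *: eta - a' * x0.
have Pdel : del \in P by rewrite rpredB ?rpredZ ?lP.
have delM : del * i \in M.
  rewrite mulrBl -scalerAl -/b -mulrA.
  have -> : b - a' * (x0 * i) = a' * (1 - x0 * i) - a.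
    by rewrite mulrBr mulr1 addrAC /a' [a + b]addrC addrK.
  by rewrite rpredB // lM.
pose D := limg (amulr del).
have lD : left_ideal D := @left_ideal_amulr del.
have DP : (D <= P)%VS by apply/subvP => _ /mem_amulr[y ->]; apply: lP.
(* Otherwise [D] would be all of [P] by minimality, and [r] a multiple of [del]; but [del * i] is in
   [M] while [r * i] is not. *)
have DM u y : u \in D -> u * y \in M.
  move=> Du; apply: contraT => uyM.
  have PD : (P <= D)%VS by apply: Pmin => //; split=> //; exists u, y.
  have /mem_amulr[z rz] := subvP PD _ Pr_r.
  by case/negP: riM; rewrite rz -mulrA lM.
have Ddel : del \in D by apply/mem_amulr; exists 1; rewrite mul1r.
have Jdel : in_radical del.
  (* If [M'] misses [del], an element of [D] can be subtracted from [r] to land in [M']. This does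
     not change [r * i] modulo [M], so [P :&: M'] still acts nontrivially, and it is [P] by
     minimality. *)
  move=> M' maxM'; have [lM' _ _] := maxM'; apply: contraT => delM'.
  have DM' := max_left_ideal_add maxM' lD Ddel delM'.
  have lPM' : left_ideal (P :&: M')%VS by apply: left_idealI.
  have PPM' : (P <= P :&: M')%VS.
    apply: Pmin; last exact: capvSl; split=> //.
    have [u Du ruM'] := DM' r; exists (r - u), i; split.
      by rewrite memv_cap ruM' rpredB // (subvP DP).
    apply: contra riM => H.
    by rewrite -(subrK u r) mulrDl rpredD // DM.
  by case/negP: delM'; have := subvP PPM' _ Pdel; rewrite memv_cap => /andP[].
have sub : (limg (amull a) + J <= limg (amull a') + J)%VS.
  rewrite subv_add addvSr andbT; apply/subvP => _ /mem_amull[y ->].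
  have -> : a * y = a' * (y - x0 * i * y) - del * i * y.
    rewrite mulrBr /del !mulrBl !mulrA opprB addrA subrK.
    by rewrite /a' mulrDl /b -!scalerAl addrK.
  apply: memv_add; first by apply/mem_amull; eexists.
  by rewrite rpredN -mulrA; apply/JP/in_radicalMr.
rewrite ltn_neqAle dimvS // andbT; apply: contra etaM => /eqP dimE.
have /eqP E : (limg (amull a) + J == limg (amull a') + J)%VS.
  by rewrite eqEdim sub dimE leqnn.
have a'E : a' \in (limg (amull a) + M)%VS.
  apply: (subvP (addvS (subvv _) JM)); rewrite E.
  by apply: (subvP (addvSl _ _)); apply/mem_amull; exists 1; rewrite mulr1.
rewrite -[eta * i]scale1r -(mulVf c0) -scalerA rpredZ // -/b.
rewrite -[b](addrK a) addrC [b + a]addrC -/a' addrC rpredB //.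
by apply: (subvP (addvSl _ _)); apply/mem_amull; exists 1; rewrite mulr1.
Qed.

End RankIncrease.

(** Induction on the codimension of $aB+J$. [I0] stands for the elements of [I] that lift to the
    algebra under study. Only some nonzero multiple of the [b] from [rank_increase] is known to lie
    in it, which is why that lemma allows every nonzero [c]. *)
Theorem stable_range_one (I0 : B -> Prop) a d I :
    left_ideal I -> 1 - d * a \in I ->
    I0 0 -> (forall x y, I0 x -> I0 y -> I0 (x + y)) ->
    (forall x, I0 x -> x \in I) ->
    (forall x, x \in I -> exists2 c, c != 0 & I0 (c *: x)) ->
  exists b y, I0 b /\ y * (a + b) = 1.
Proof.
move=> lI aI I00 I0D I0I I0s.
have [||J JP] := @vspace_of K B in_radical.
- by move=> M _; apply: mem0v.
- by move=> k u v Ju Jv M maxM; rewrite rpredD ?rpredZ ?Ju ?Jv.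
have [n] := ubnP (\dim {:B} - \dim (limg (amull a) + J)%VS).
elim: n a d aI => // n IHn a d aI le_n.
have [[y ya]|/forallNP a_sing] := pselect (exists y, y * a = 1).
  by exists 0, y; rewrite addr0.
have [|b Ib lt_b] := rank_increase JP lI aI.
  by move=> y; apply/eqP/a_sing.
have [c c0 I0b] := I0s _ Ib.
have [||b' [y [I0b' yE]]] := IHn (a + c *: b) d.
- by rewrite mulrDr opprD addrA rpredB // lI // rpredZ.
- rewrite -ltnS; apply: leq_trans le_n; rewrite ltnS ltn_sub2l ?lt_b //.
  by apply: leq_trans (lt_b _ c0) _; apply/dimvS/subvf.
by exists (c *: b + b'), y; rewrite addrA; split=> //; apply: I0D.
Qed.

(* Vaserstein's transfer of the stable range condition to the other side *)
Corollary stable_range_one_op a x : exists t y, y * (a + (1 - a * x) * t) = 1.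
Proof.
set b := 1 - a * x.
have [||||||_ [y [[t ->] yt]]] :=
    @stable_range_one (fun z => exists t, z = t * b) x a (limg (amulr b)).
- exact: left_ideal_amulr.
- by apply/mem_amulr; exists 1; rewrite mul1r.
- by exists 0; rewrite mul0r.
- by move=> _ _ [t ->] [t' ->]; exists (t + t'); rewrite mulrDl.
- by move=> _ [t ->]; apply/mem_amulr; exists t.
- move=> _ /mem_amulr[t ->]; exists 1; rewrite ?oner_eq0 ?scale1r //.
  by exists t.
set u := x + t * b in yt.
have [u' uu'] := left_inverse_right yt.
(* As $tb=u-x$ and $xb=(1-xa)x$, the factor $(1-xa)tb+xb$ is $(1-xa)u$. Then $uu'=1$ leaves
   $(1-xa)(1-ta)$, which completes $(1-xa)ta+xa$ to 1. *)
exists (u' * (1 - t * a)), ((1 - x * a) * t + x).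
have tb : t * b = u - x by rewrite /u addrC addKr.
have xb : x * b = (1 - x * a) * x by rewrite mulrBr mulrBl mulr1 mul1r mulrA.
have -> : ((1 - x * a) * t + x) * (a + b * (u' * (1 - t * a))) =
  (1 - x * a) * (t * a) + x * a +
  ((1 - x * a) * (t * b) + x * b) * (u' * (1 - t * a)).
  by move: (1 - x * a) (1 - t * a) (b) => e e' b'; rewrite mulrDr !mulrDl !mulrA.
rewrite tb xb mulrBr subrK. rewrite -!mulrA (mulrA u) uu' mul1r [_ * (1 - t * a)]mulrBr.
by rewrite mulr1 addrC addrA !subrK.
Qed.

End LeftIdeals.

(** * The residue field of a prime ideal *)

Section PrimeIdeals.
Context {R : comPzRingType} (p : Spec R).
Implicit Types r s x y : R.

Lemma spec0 : 0 \in p.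
Proof. by case: (spec_prime p) => -[]. Qed.

Lemma spec1 : 1 \notin p.
Proof. by case: (spec_prime p). Qed.

Lemma specD x y : x \in p -> y \in p -> x + y \in p.
Proof. by case: (spec_prime p) => -[_ pM] _ _ px py; rewrite -[x]mul1r pM. Qed.

Lemma specMr x y : y \in p -> x * y \in p.
Proof. by case: (spec_prime p) => -[p0 pM] _ _ py; rewrite -[_ * _]addr0 pM. Qed.

Lemma specMl x y : x \in p -> x * y \in p.
Proof. by rewrite mulrC; apply: specMr. Qed.

Lemma specN x : x \in p -> - x \in p.
Proof. by rewrite -mulN1r; apply: specMr. Qed.

Lemma spec_mul x y : (x * y \in p) = (x \in p) || (y \in p).
Proof.
apply/idP/orP => [xy|[px|py]]; [|exact: specMl|exact: specMr].
by case: (spec_prime p) => _ _ /(_ _ _ xy)/orP.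
Qed.

Lemma spec_mulF x y : x \notin p -> y \notin p -> x * y \notin p.
Proof. by move=> px py; rewrite spec_mul (negPf px). Qed.

Lemma spec_prodF (I : finType) (f : I -> R) :
  (forall i, f i \notin p) -> \prod_i f i \notin p.
Proof.
move=> pf; elim/big_rec: _ => [|i x _ px]; first exact: spec1.
exact: spec_mulF.
Qed.

End PrimeIdeals.

Section ResidueField.
Local Open Scope quotient_scope.
Context {R : comPzRingType} (p : Spec R).
Implicit Types (r x y : R) (s t u : denom p).

(** The fraction field of $R/p$ is formed in a single quotient: fractions with denominator outside
    [p], compared modulo [p]. *)
Definition res_rel : rel (R * denom p) :=
  fun a b => sval b.2 * a.1 - sval a.2 * b.1 \in p.

Fact res_rel_refl : reflexive res_rel.
Proof. by move=> a; rewrite /res_rel subrr spec0. Qed.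

Fact res_rel_sym : symmetric res_rel.
Proof.
by move=> a b; rewrite /res_rel; apply/idP/idP => /specN; rewrite opprB.
Qed.

Fact res_rel_trans : transitive res_rel.
Proof.
move=> [y t] [x s] [z u]; rewrite /res_rel /= => xy yz.
have : sval t * (sval u * x - sval s * z) \in p.
  have -> : sval t * (sval u * x - sval s * z) =
    sval u * (sval t * x - sval s * y) + sval s * (sval u * y - sval t * z).
    by ring.
  by rewrite specD ?specMr.
by rewrite spec_mul (negPf (svalP t)).
Qed.

Canonical res_equiv := EquivRel res_rel res_rel_refl res_rel_sym res_rel_trans.

Definition residue_field : Type := {eq_quot res_rel}.
HB.instance Definition _ : EqQuotient _ res_rel residue_field :=
  EqQuotient.on residue_field.
HB.instance Definition _ := Choice.on residue_field.

Definition rfrac x s : residue_field := \pi_residue_field (x, s).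

Lemma rfracP x s y t : rfrac x s = rfrac y t <-> sval t * x - sval s * y \in p.
Proof. by split=> [/eqquotP|xy]; last apply/eqquotP. Qed.

Lemma rfracW (a : residue_field) : exists x s, a = rfrac x s.
Proof.
by exists (repr a).1, (repr a).2; rewrite /rfrac -surjective_pairing reprK.
Qed.

Lemma rfrac_repr x s :
  sval (repr (rfrac x s)).2 * x - sval s * (repr (rfrac x s)).1 \in p.
Proof. by apply/rfracP; rewrite /rfrac -surjective_pairing reprK. Qed.

Definition res_add (a b : residue_field) : residue_field :=
  rfrac (sval (repr b).2 * (repr a).1 + sval (repr a).2 * (repr b).1)
        (denom_mul (repr a).2 (repr b).2).
Definition res_opp (a : residue_field) : residue_field :=
  rfrac (- (repr a).1) (repr a).2.
Definition res_mul (a b : residue_field) : residue_field :=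
  rfrac ((repr a).1 * (repr b).1) (denom_mul (repr a).2 (repr b).2).
Definition res_inv (a : residue_field) : residue_field :=
  match boolP ((repr a).1 \in p) with
  | AltTrue _ => rfrac 0 (denom_one p)
  | AltFalse np => rfrac (sval (repr a).2) (exist _ (repr a).1 np)
  end.

Lemma res_addE x s y t :
  res_add (rfrac x s) (rfrac y t) =
  rfrac (sval t * x + sval s * y) (denom_mul s t).
Proof.
rewrite /res_add; have := rfrac_repr x s; have := rfrac_repr y t.
case: (repr (rfrac x s)) (repr (rfrac y t)) => [x' s'] [y' t'] /= yE xE.
apply/rfracP => /=.
rewrite [X in X \in _](_ : _ = - (sval t * sval t' * (sval s' * x - sval s * x')
   + sval s * sval s' * (sval t' * y - sval t * y'))); last by ring.
by rewrite specN ?specD ?specMr.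
Qed.

Lemma res_oppE x s : res_opp (rfrac x s) = rfrac (- x) s.
Proof.
rewrite /res_opp; have := rfrac_repr x s; case: (repr _) => x' s' /= xE.
apply/rfracP => /=.
by rewrite [X in X \in _](_ : _ = sval s' * x - sval s * x'); last by ring.
Qed.

Lemma res_mulE x s y t :
  res_mul (rfrac x s) (rfrac y t) = rfrac (x * y) (denom_mul s t).
Proof.
rewrite /res_mul; have := rfrac_repr x s; have := rfrac_repr y t.
case: (repr (rfrac x s)) (repr (rfrac y t)) => [x' s'] [y' t'] /= yE xE.
apply/rfracP => /=.
rewrite [X in X \in _](_ : _ = - (sval t' * y * (sval s' * x - sval s * x')
   + sval s * x' * (sval t' * y - sval t * y'))); last by ring.
by rewrite specN ?specD ?specMr.
Qed.

Lemma rfrac_eq0 x s : rfrac x s = rfrac 0 (denom_one p) <-> x \in p.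
Proof. by rewrite rfracP /= mul1r mulr0 subr0. Qed.

Let res0 := rfrac 0 (denom_one p).
Let res1 := rfrac 1 (denom_one p).

Lemma rfrac_eq x s y t : sval t * x = sval s * y -> rfrac x s = rfrac y t.
Proof. by move=> xy; apply/rfracP; rewrite xy subrr spec0. Qed.

Fact res_addA : associative res_add.
Proof.
move=> a b c; have [x [s ->]] := rfracW a; have [y [t ->]] := rfracW b.
by have [z [u ->]] := rfracW c; rewrite !res_addE; apply: rfrac_eq => /=; ring.
Qed.
Fact res_addC : commutative res_add.
Proof.
move=> a b; have [x [s ->]] := rfracW a; have [y [t ->]] := rfracW b.
by rewrite !res_addE; apply: rfrac_eq => /=; ring.
Qed.
Fact res_add0 : left_id res0 res_add.
Proof. by move=> a; have [x [s ->]] := rfracW a; rewrite res_addE; apply: rfrac_eq => /=; ring. Qed.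
Fact res_addN : left_inverse res0 res_opp res_add.
Proof.
by move=> a; have [x [s ->]] := rfracW a; rewrite res_oppE res_addE; apply: rfrac_eq => /=; ring.
Qed.
HB.instance Definition _ := GRing.isZmodule.Build residue_field
  res_addA res_addC res_add0 res_addN.

Fact res_mulA : associative res_mul.
Proof.
move=> a b c; have [x [s ->]] := rfracW a; have [y [t ->]] := rfracW b.
by have [z [u ->]] := rfracW c; rewrite !res_mulE; apply: rfrac_eq => /=; ring.
Qed.
Fact res_mulC : commutative res_mul.
Proof.
move=> a b; have [x [s ->]] := rfracW a; have [y [t ->]] := rfracW b.
by rewrite !res_mulE; apply: rfrac_eq => /=; ring.
Qed.
Fact res_mul1 : left_id res1 res_mul.
Proof. by move=> a; have [x [s ->]] := rfracW a; rewrite res_mulE; apply: rfrac_eq => /=; ring. Qed.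
Fact res_mulDl : left_distributive res_mul res_add.
Proof.
move=> a b c; have [x [s ->]] := rfracW a; have [y [t ->]] := rfracW b.
by have [z [u ->]] := rfracW c; rewrite !(res_addE, res_mulE); apply: rfrac_eq => /=; ring.
Qed.
Fact res_1neq0 : res1 != res0.
Proof. by apply/eqP => /rfrac_eq0; apply/negP/spec1. Qed.
HB.instance Definition _ := GRing.Zmodule_isComNzRing.Build residue_field
  res_mulA res_mulC res_mul1 res_mulDl res_1neq0.

Lemma rfrac_reprK (a : residue_field) : rfrac (repr a).1 (repr a).2 = a.
Proof. by rewrite /rfrac -surjective_pairing reprK. Qed.

Fact res_mulV (a : residue_field) : a != 0 -> res_inv a * a = 1.
Proof.
move=> a0; rewrite /res_inv; case: {-}_ / boolP => [pa|np].
  by case/eqP: a0; rewrite -[a]rfrac_reprK; apply/rfrac_eq0.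
rewrite -[X in _ * X]rfrac_reprK [LHS]res_mulE.
by apply/rfracP; rewrite /= mul1r mulr1 mulrC subrr spec0.
Qed.
Fact res_inv0 : res_inv 0 = 0.
Proof.
rewrite /res_inv; case: {-}_ / boolP => // np.
by case/negP: np; apply/rfrac_eq0; apply: (rfrac_reprK (0 : residue_field)).
Qed.
HB.instance Definition _ := GRing.ComNzRing_isField.Build residue_field
  res_mulV res_inv0.

Definition res_map x : residue_field := rfrac x (denom_one p).

Fact res_map_is_zmod : zmod_morphism res_map.
Proof.
move=> x y; transitivity (res_add (res_map x) (res_opp (res_map y))) => //.
by rewrite res_oppE res_addE; apply: rfrac_eq => /=; ring.
Qed.
Fact res_map_is_monoid : monoid_morphism res_map.
Proof.
split=> // x y; transitivity (res_mul (res_map x) (res_map y)) => //.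
by rewrite res_mulE; apply: rfrac_eq => /=; ring.
Qed.
HB.instance Definition _ := GRing.isZmodMorphism.Build R residue_field res_map
  res_map_is_zmod.
HB.instance Definition _ := GRing.isMonoidMorphism.Build R residue_field res_map
  res_map_is_monoid.

Lemma res_map_eq0 x : (res_map x == 0) = (x \in p).
Proof.
have E := rfrac_eq0 x (denom_one p).
by apply/eqP/idP => [/(iffLR E)|/(iffRL E)].
Qed.

Lemma res_mapW (a : residue_field) :
  exists x r, r \notin p /\ a = res_map x / res_map r.
Proof.
have [x [s ->]] := rfracW a; exists x, (sval s); split; first exact: (svalP s).
have s0 : res_map (sval s) != 0 by rewrite res_map_eq0 (svalP s).
apply: (canRL (mulfK s0)).
transitivity (res_mul (rfrac x s) (res_map (sval s))) => //.
by rewrite res_mulE; apply: rfrac_eq => /=; ring.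
Qed.

End ResidueField.

(** * Module-finite algebras at a prime ideal *)

Section Submodules.
Context {A : pzRingType} {Q : lmodType A}.
Implicit Types (P : Q -> Prop) (u v : Q).

Definition submodule P := P 0 /\ forall a u v, P u -> P v -> P (a *: u + v).

Lemma submodule0 P : submodule P -> P 0. Proof. by case. Qed.
Lemma submoduleD P u v : submodule P -> P u -> P v -> P (u + v).
Proof. by case=> _ H Pu Pv; rewrite -[u]scale1r; apply: H. Qed.
Lemma submoduleZ P a u : submodule P -> P u -> P (a *: u).
Proof. by case=> P0 H Pu; rewrite -[_ *: _]addr0; apply: H. Qed.
Lemma submoduleN P u : submodule P -> P u -> P (- u).
Proof. by move=> sP Pu; rewrite -scaleN1r; apply: submoduleZ. Qed.
Lemma submoduleB P u v : submodule P -> P u -> P v -> P (u - v).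
Proof. by move=> sP Pu Pv; apply: submoduleD => //; apply: submoduleN. Qed.
Lemma submodule_sum P (I : finType) (f : I -> Q) :
  submodule P -> (forall i, P (f i)) -> P (\sum_i f i).
Proof.
move=> sP Pf; elim/big_rec: _ => [|i u _ Pu]; first exact: submodule0.
exact: submoduleD.
Qed.

End Submodules.

Section Nakayama.
Context {R : comPzRingType} {A : pzRingType} (alpha : algebra R A) (p : Spec R).
Context {Q : lmodType A} (P : Q -> Prop) (sP : submodule P).

(** The determinant of $s-C$ sends every [v i] into [P], by the adjugate, and it is $s^n$ modulo
    [p]. Explicit denominators replace localized modules here and below. *)
Lemma nakayama n (v : 'I_n -> Q) s : s \notin p ->
  (forall i, exists c : 'I_n -> R, (forall j, c j \in p) /\
     P (alpha s *: v i - \sum_j alpha (c j) *: v j)) ->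
  exists2 t, t \notin p & forall i, P (alpha t *: v i).
Proof.
move=> ps /choice[c /all_and2[pc Pc]].
pose C := \matrix_(i, j) c i j; pose M := s%:M - C.
exists (\det M).
  rewrite -res_map_eq0 -det_map_mx map_mxB map_scalar_mx.
  have -> : map_mx (res_map p) C = 0.
    by apply/matrixP => i j; rewrite !mxE; apply/eqP; rewrite res_map_eq0.
  by rewrite subr0 det_scalar expf_neq0 // res_map_eq0.
move=> i.
have -> : alpha (\det M) *: v i =
    \sum_k alpha ((\adj M) i k) *: (\sum_j alpha (M k j) *: v j).
  under eq_bigr do (rewrite scaler_sumr; under eq_bigr do rewrite scalerA -rmorphM).
  rewrite exchange_big /=.
  under eq_bigr => j _ do rewrite -scaler_suml -raddf_sum /=.
  have E j : \sum_k (\adj M) i k * M k j = (\adj M *m M) i j by rewrite mxE.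
  under eq_bigr => j _ do rewrite E mul_adj_mx mxE.
  rewrite (bigD1 i) //= eqxx mulr1n big1 ?addr0 // => j ji.
  by rewrite eq_sym (negPf ji) mulr0n rmorph0 scale0r.
apply: submodule_sum => // k; apply: submoduleZ => //.
have -> : \sum_j alpha (M k j) *: v j =
    alpha s *: v k - \sum_j alpha (c k j) *: v j.
  rewrite -(sub0r (\sum_j _)); rewrite addrA addr0.
  under eq_bigr => j _ do rewrite !mxE rmorphB scalerBl.
  rewrite sumrB; congr (_ - _).
  rewrite (bigD1 k) //= eqxx mulr1n big1 ?addr0 // => j jk.
  by rewrite eq_sym (negPf jk) mulr0n rmorph0 scale0r.
exact: Pc.
Qed.

End Nakayama.

Section LocalAlgebra.
Context {R : comPzRingType} {A : pzRingType} (alpha : algebra R A) (p : Spec R).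
Context {l : nat} (g : 'I_l -> A).
Hypothesis gP : forall x, exists c : 'I_l -> R, x = \sum_i alpha (c i) * g i.
Implicit Types (x y : A) (r s : R).
Local Notation K := (residue_field p).
Local Notation phi := (res_map p).

Let alphaAC r x y : x * (alpha r * y) = alpha r * (x * y).
Proof. by rewrite !mulrA -alg_mapC. Qed.

Definition in_pA x :=
  exists2 c : 'I_l -> R, forall i, c i \in p & x = \sum_i alpha (c i) * g i.

Lemma in_pA0 : in_pA 0.
Proof.
exists (fun=> 0) => [i|]; first exact: spec0.
by rewrite big1 // => i _; rewrite rmorph0 mul0r.
Qed.

Lemma in_pAD x y : in_pA x -> in_pA y -> in_pA (x + y).
Proof.
move=> [c pc ->] [d pd ->]; exists (fun i => c i + d i).
  by move=> i; apply: specD.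
by rewrite -big_split; apply: eq_bigr => i _; rewrite rmorphD mulrDl.
Qed.

Lemma in_pA_sum (I : finType) (f : I -> A) :
  (forall i, in_pA (f i)) -> in_pA (\sum_i f i).
Proof.
by move=> pf; elim/big_rec: _ => [|i x _]; [exact: in_pA0 | exact: in_pAD].
Qed.

Lemma in_pAZ r x : r \in p -> in_pA (alpha r * x).
Proof.
move=> pr; have [c ->] := gP x; exists (fun i => r * c i).
  by move=> i; apply: specMl.
by rewrite mulr_sumr; apply: eq_bigr => i _; rewrite mulrA -rmorphM.
Qed.

Lemma in_pAMl x y : in_pA y -> in_pA (x * y).
Proof.
move=> [c pc ->]; rewrite mulr_sumr; apply: in_pA_sum => i.
by rewrite alphaAC; apply: in_pAZ.
Qed.

Lemma in_pAMr x y : in_pA x -> in_pA (x * y).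
Proof.
move=> [c pc ->]; rewrite mulr_suml; apply: in_pA_sum => i.
by rewrite -mulrA; apply: in_pAZ.
Qed.

(* membership in the contraction to A of p A_p *)
Definition in_locp x := exists2 s, s \notin p & in_pA (alpha s * x).

Lemma in_locp_pA x : in_pA x -> in_locp x.
Proof. by exists 1; [exact: spec1 | rewrite rmorph1 mul1r]. Qed.

Lemma in_locp0 : in_locp 0.
Proof. exact/in_locp_pA/in_pA0. Qed.

Lemma in_locpMl x y : in_locp y -> in_locp (x * y).
Proof. by move=> [s ps sy]; exists s => //; rewrite -alphaAC; apply: in_pAMl. Qed.

Lemma in_locpMr x y : in_locp x -> in_locp (x * y).
Proof. by move=> [s ps sx]; exists s => //; rewrite mulrA; apply: in_pAMr. Qed.

Lemma in_locpN x : in_locp x -> in_locp (- x).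
Proof. by move=> /(in_locpMl (-1)); rewrite mulN1r. Qed.

Lemma in_locpD x y : in_locp x -> in_locp y -> in_locp (x + y).
Proof.
move=> [s ps sx] [t pt ty]; exists (s * t); first exact: spec_mulF.
rewrite mulrDr [in X in X * x]mulrC !rmorphM -!mulrA.
by apply: in_pAD; apply: in_pAMl.
Qed.

Lemma in_locpB x y : in_locp x -> in_locp y -> in_locp (x - y).
Proof. by move=> px py; apply/in_locpD/in_locpN. Qed.

Lemma in_locp_sum (I : finType) (f : I -> A) :
  (forall i, in_locp (f i)) -> in_locp (\sum_i f i).
Proof.
by move=> pf; elim/big_rec: _ => [|i x _]; [exact: in_locp0 | exact: in_locpD].
Qed.

Lemma in_locp_div s x : s \notin p -> in_locp (alpha s * x) -> in_locp x.
Proof.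
move=> ps [t pt tx]; exists (t * s); first exact: spec_mulF.
by rewrite rmorphM -mulrA.
Qed.

Definition left_inv_at x := exists y s, s \notin p /\ y * x = alpha s.

(** Nakayama's lemma for $A/Ax$, generated by the [g i]: left inverses lift from $A_p/pA_p$ to
    $A_p$. *)
Lemma left_inv_mod x y s : s \notin p -> in_locp (y * x - alpha s) ->
  left_inv_at x.
Proof.
move=> ps [t pt tyx].
have sP : submodule (fun z : A^o => exists y, z = y * x).
  split=> [|a _ _ [y1 ->] [y2 ->]]; first by exists 0; rewrite mul0r.
  by exists (a * y1 + y2); rewrite mulrDl -mulrA.
have [||u pu uP] := @nakayama R A alpha p A^o _ sP l g (t * s).
- exact: spec_mulF.
- move=> j; have [c pc cE] := in_pAMl (g j) tyx.
  exists (fun i => - c i); split=> [i|]; first exact: specN.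
  exists (g j * (alpha t * y)).
  transitivity (alpha (t * s) * g j + \sum_i alpha (c i) * g i).
    rewrite -sumrN; congr (_ + _); apply: eq_bigr => i _.
    by rewrite rmorphN scaleNr opprK.
  by rewrite -cE alg_mapC rmorphM !mulrBr addrC subrK !mulrA.
have [c c1] := gP 1.
have [y' y'E] : exists y', alpha u = y' * x.
  have -> : alpha u = \sum_i (alpha (c i) : A) *: (alpha u *: (g i : A^o)).
    rewrite -[LHS]mulr1 c1 mulr_sumr; apply: eq_bigr => i _.
    exact: alphaAC.
  by apply: (submodule_sum sP) => i; apply: (submoduleZ _ sP (uP i)).
by exists y', u.
Qed.

Definition spans_at n (x : 'I_n -> A) := forall y, exists s (r : 'I_n -> R),
  s \notin p /\ in_locp (alpha s * y - \sum_i alpha (r i) * x i).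

Lemma basis_at : exists n (x : 'I_n -> A), spans_at x /\
  forall r : 'I_n -> R, in_locp (\sum_i alpha (r i) * x i) ->
    forall i, r i \in p.
Proof.
pose D n := `[< exists x : 'I_n -> A, spans_at x >].
have exD : exists n, D n.
  exists l; apply/asboolP; exists g => y; have [c ->] := gP y.
  exists 1, c; split; first exact: spec1.
  by rewrite rmorph1 mul1r subrr; apply: in_locp0.
case: (ex_minnP exD) => -[|n] /asboolP[x xP] minn.
  by exists 0%N, x; split=> // r _ [].
exists n.+1, x; split=> // r rP i; apply: contraT => pri.
suff /minn : D n by rewrite ltnn.
apply/asboolP; exists (fun j => x (lift i j)) => y.
have [s [c [ps cP]]] := xP y.
exists (r i * s), (fun j => r i * c (lift i j) - c i * r (lift i j)).
split; first exact: spec_mulF.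
have H := in_locpD (in_locpMl (alpha (r i)) cP) (in_locpMl (alpha (c i)) rP).
apply: (eq_ind _ in_locp H) => {H}.
rewrite mulrBr mulrA -rmorphM -addrA; congr (_ + _).
rewrite !mulr_sumr -sumrN -big_split -sumrN (bigD1_ord i) //=.
rewrite !mulrA -!rmorphM [c i * r i]mulrC addNr add0r; apply: eq_bigr => j _.
by rewrite rmorphB mulrBl opprB addrC !mulrA !rmorphM.
Qed.

Section Coordinates.
Context {n : nat} (x : 'I_n -> A).
Hypothesis xP : spans_at x.
Hypothesis x_free : forall r : 'I_n -> R, in_locp (\sum_i alpha (r i) * x i) ->
  forall i, r i \in p.

Lemma coordinates_ex y : exists v : 'rV[K]_n, exists s (r : 'I_n -> R),
  [/\ s \notin p, in_locp (alpha s * y - \sum_i alpha (r i) * x i)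
    & v = \row_i (phi (r i) / phi s)].
Proof. by have [s [r [ps rP]]] := xP y; exists (\row_i (phi (r i) / phi s)), s, r. Qed.

Definition coordinates y : 'rV[K]_n := projT1 (cid (coordinates_ex y)).

Lemma coordinatesE y s (r : 'I_n -> R) : s \notin p ->
  in_locp (alpha s * y - \sum_i alpha (r i) * x i) ->
  phi s *: coordinates y = \row_i phi (r i).
Proof.
move=> ps rP; rewrite /coordinates; case: cid => v /= [t [c [pt cP ->]]].
apply/rowP => i; rewrite !mxE mulrA.
have t0 : phi t != 0 by rewrite res_map_eq0.
apply: (canLR (mulfK t0)); rewrite -!rmorphM; apply/eqP.
rewrite -subr_eq0 -rmorphB res_map_eq0.
have H := in_locpB (in_locpMl (alpha s) cP) (in_locpMl (alpha t) rP).
suff E : in_locp (\sum_i alpha (s * c i - r i * t) * x i).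
  exact: (x_free (r := fun i => s * c i - r i * t) E).
apply/(eq_ind _ in_locp (in_locpN H)) => {H}.
rewrite opprB !mulrBr !mulrA -!rmorphM [t * s]mulrC opprB addrC addrA subrK.
rewrite !mulr_sumr -sumrB; apply: eq_bigr => j _.
by rewrite !mulrA -!rmorphM -mulrBl -rmorphB [r j * t]mulrC.
Qed.

Lemma coordinates_lin r y z :
  coordinates (alpha r * y + z) = phi r *: coordinates y + coordinates z.
Proof.
have [s [c [ps cP]]] := xP y; have [t [d [pt dP]]] := xP z.
have st0 : phi (s * t) != 0 by rewrite res_map_eq0 spec_mulF.
apply: (scalerI st0).
rewrite (@coordinatesE _ _ (fun i => t * r * c i + s * d i) (spec_mulF ps pt)).
  2: {
  have H := in_locpD (in_locpMl (alpha (t * r)) cP) (in_locpMl (alpha s) dP).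
  apply: (eq_ind _ in_locp H) => {H}.
  rewrite !mulrBr mulrDr !mulrA -!rmorphM addrACA -opprD; congr (alpha _ * _ + _ - _).
    by ring.
  rewrite !mulr_sumr -big_split; apply: eq_bigr => i _ /=.
  by rewrite !mulrA -!rmorphM -mulrDl -rmorphD. }
have -> : phi (s * t) *: (phi r *: coordinates y + coordinates z) =
    phi (t * r) *: (phi s *: coordinates y) + phi s *: (phi t *: coordinates z).
  by rewrite scalerDr !scalerA -!rmorphM; congr (phi _ *: _ + _); ring.
rewrite (coordinatesE ps cP) (coordinatesE pt dP).
by apply/rowP => i; rewrite !mxE rmorphD !rmorphM.
Qed.

Lemma coordinates_eq0 y : coordinates y = 0 <-> in_locp y.
Proof.
split=> [y0|py]; last first.
  rewrite -[coordinates y]scale1r -(rmorph1 phi).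
  rewrite (@coordinatesE _ _ (fun=> 0)) ?spec1 //.
    by apply/rowP => i; rewrite !mxE rmorph0.
  rewrite rmorph1 mul1r big1 ?subr0 // => i _.
  by rewrite rmorph0 mul0r.
have [s [c [ps cP]]] := xP y; have := coordinatesE ps cP.
rewrite y0 scaler0 => /rowP c0; apply: (in_locp_div ps).
rewrite -[_ * y](subrK (\sum_i alpha (c i) * x i)); apply: in_locpD => //.
apply: in_locp_sum => i; apply/in_locp_pA/in_pAZ.
by have /esym/eqP := c0 i; rewrite !mxE res_map_eq0.
Qed.

Lemma coordinates0 : coordinates 0 = 0.
Proof. exact/coordinates_eq0/in_locp0. Qed.

Lemma coordinatesZ r y : coordinates (alpha r * y) = phi r *: coordinates y.
Proof. by rewrite -[_ * y]addr0 coordinates_lin coordinates0 addr0. Qed.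

Lemma coordinatesD y z : coordinates (y + z) = coordinates y + coordinates z.
Proof. by have := coordinates_lin 1 y z; rewrite !rmorph1 mul1r scale1r. Qed.

Lemma coordinates_sum (I : finType) (f : I -> A) :
  coordinates (\sum_i f i) = \sum_i coordinates (f i).
Proof. exact: (big_morph _ coordinatesD coordinates0). Qed.

Lemma coordinates_basis i : coordinates (x i) = delta_mx 0 i.
Proof.
rewrite -[coordinates _]scale1r -(rmorph1 phi).
rewrite (@coordinatesE _ _ (fun j => (i == j)%:R)) ?spec1 //.
  by apply/rowP => j; rewrite !mxE rmorph_nat eq_sym.
rewrite rmorph1 mul1r (bigD1 i) //= eqxx rmorph1 mul1r big1 ?addr0 ?subrr.
  exact: in_locp0.
by move=> j; rewrite eq_sym => /negPf ->; rewrite rmorph0 mul0r.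
Qed.

(** Coordinates are rows, so matrices of right multiplications multiply in the same order as the
    elements, and no opposite ring appears. *)
Definition act_mx a : 'M[K]_n := \matrix_i coordinates (x i * a).

Lemma coordinatesM y a : coordinates (y * a) = coordinates y *m act_mx a.
Proof.
have [s [c [ps cP]]] := xP y.
have s0 : phi s != 0 by rewrite res_map_eq0.
apply: (scalerI s0); rewrite -coordinatesZ scalemxAl (coordinatesE ps cP).
rewrite mulmx_sum_row; have -> : alpha s * (y * a) =
    (alpha s * y - \sum_i alpha (c i) * x i) * a + (\sum_i alpha (c i) * x i) * a.
  by rewrite -mulrDl subrK mulrA.
rewrite coordinatesD (iffRL (coordinates_eq0 _) (in_locpMr a cP)) add0r.
rewrite mulr_suml coordinates_sum; apply: eq_bigr => i _.
by rewrite -mulrA coordinatesZ mxE rowK.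
Qed.

Lemma act_mx_lin r a b : act_mx (alpha r * a + b) = phi r *: act_mx a + act_mx b.
Proof.
apply/row_matrixP => i; rewrite linearP /= !rowK.
by rewrite mulrDr alphaAC coordinates_lin.
Qed.

Lemma act_mx1 : act_mx 1 = 1%:M.
Proof. by apply/row_matrixP => i; rewrite rowK mulr1 coordinates_basis row1. Qed.

Lemma act_mxM a b : act_mx (a * b) = act_mx a *m act_mx b.
Proof.
by apply/row_matrixP => i; rewrite row_mul !rowK mulrA coordinatesM.
Qed.

Lemma act_mx_eq0 a : act_mx a = 0 -> in_locp a.
Proof. by move=> a0; apply/coordinates_eq0; rewrite -[a]mul1r coordinatesM a0 mulmx0. Qed.

End Coordinates.

(* The algebra A_p / p A_p over the residue field, whose elements are
   represented by the matrices of their right multiplications. *)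
Theorem local_algebra : ~ in_locp 1 ->
  exists (B : falgType K) (psi : {rmorphism A -> B}),
    [/\ forall r a, psi (alpha r * a) = phi r *: psi a,
        forall b, exists a s, s \notin p /\ phi s *: b = psi a
      & forall a, psi a = 0 -> in_locp a].
Proof.
move=> p1; have [n [x [xP x_free]]] := basis_at; case: n => [|n] in x xP x_free *.
  (* An empty basis would put 1 into the contraction of $pA_p$. A positive size is required for the
     matrices to form a nonzero algebra. *)
  case: p1; have [s [r [ps]]] := xP 1; rewrite big_ord0 subr0.
  exact: in_locp_div.
pose rho : A -> 'M[K]_n.+1 := act_mx xP.
have rhoD a b : rho (a + b) = rho a + rho b.
  by have := act_mx_lin xP x_free 1 a b; rewrite !rmorph1 mul1r scale1r.
have rho0 : rho 0 = 0 by apply: (addrI (rho 0)); rewrite -rhoD !addr0.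
have rhoZ r a : rho (alpha r * a) = phi r *: rho a.
  by rewrite -[_ * a]addr0 /rho act_mx_lin // -/rho rho0 addr0.
(* This is the $K$-span of the image of [rho]: finitely many scalars of $K$ have a common
   denominator outside [p]. *)
have [||B BP] := @vspace_of K 'M[K]_n.+1
    (fun b => exists a s, s \notin p /\ phi s *: b = rho a).
- by exists 0, 1; rewrite scaler0 rho0; split=> //; apply: spec1.
- move=> k b b' [a [s [ps sb]]] [a' [s' [ps' sb']]].
  have [r [t [pt ->]]] := res_mapW k.
  exists (alpha (r * s') * a + alpha (t * s) * a'), (t * s * s').
  split; first by rewrite !spec_mulF.
  have t0 : phi t != 0 by rewrite res_map_eq0.
  rewrite rhoD !rhoZ -sb -sb' scalerDr !scalerA !rmorphM.
  by congr (_ *: _ + _ *: _); field.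
have Brho a : rho a \in B.
  by apply/BP; exists a, 1; rewrite rmorph1 scale1r; split=> //; apply: spec1.
have B1 : 1 \in B by rewrite -[1](act_mx1 xP).
have BB : (B * B <= B)%VS.
  apply/prodvP => b b' /BP[a [s [ps sb]]] /BP[a' [s' [ps' sb']]].
  apply/BP; exists (a * a'), (s * s'); split; first exact: spec_mulF.
  by rewrite /rho act_mxM // rmorphM -scalerA scalerAr scalerAl sb sb'.
have aB : is_aspace B by rewrite /is_aspace has_algid1.
pose B' := ASpace aB; have algid1 : algid B' = 1 by apply/eqP; rewrite algid_eq1.
pose psi a : subvs_of B' := vsproj B' (rho a).
have psiK a : vsval (psi a) = rho a by apply: vsprojK.
have psi_zmod : zmod_morphism psi.
  move=> a b; apply: (addIr (psi b)); rewrite subrK; apply: val_inj.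
  by rewrite /= !psiK -rhoD subrK.
have psi_monoid : monoid_morphism psi.
  split=> [|a b]; apply: val_inj; rewrite /= !psiK /rho ?act_mxM //.
  by rewrite act_mx1 // algid1.
pose psi_add := GRing.isZmodMorphism.Build A (subvs_of B') psi psi_zmod.
pose psi_mul := GRing.isMonoidMorphism.Build A (subvs_of B') psi psi_monoid.
pose psi' : {rmorphism A -> subvs_of B'} := HB.pack psi psi_add psi_mul.
exists (subvs_of B'), psi'; split=> [r a|b|a /(congr1 vsval)].
- by apply: val_inj; rewrite /= !psiK rhoZ.
- have /BP[a [s [ps sb]]] := subvsP b; exists a, s; split=> //.
  by apply: val_inj; rewrite /= psiK.
- rewrite /= psiK => a0.
  by apply: (act_mx_eq0 (xP := xP) x_free); rewrite -/(rho a) a0.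
Qed.

(** The factor [r] is a unit at [p], so it costs nothing; later it is taken in finitely many other
    primes, so that the correction at [p] is harmless there. *)
Lemma stable_range_at (m : nat) (a d : 'I_m -> A) a0 d0 r s :
  r \notin p -> s \notin p -> d0 * a0 + \sum_i d i * a i = alpha s ->
  exists e : 'I_m -> A, left_inv_at (a0 + \sum_i alpha r * (e i * a i)).
Proof.
move=> pr ps das.
have [p1|/local_algebra[B [psi [psiZ psiW psi_inj]]]] :=
    pselect (in_locp 1).
  exists (fun=> 0); apply: (@left_inv_mod _ 0 1); first exact: spec1.
  by rewrite mul0r sub0r rmorph1; apply: in_locpN.
have s0 : phi s != 0 by rewrite res_map_eq0.
pose In (b : B) := exists e : 'I_m -> B, b = \sum_i e i * psi (a i).
have [||I IP] := @vspace_of _ _ In.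
- by exists (fun=> 0); rewrite big1 // => i _; rewrite mul0r.
- move=> k _ _ [e ->] [e' ->]; exists (fun i => k *: e i + e' i).
  rewrite scaler_sumr -big_split; apply: eq_bigr => i _.
  by rewrite mulrDl scalerAl.
pose I0 b := exists e : 'I_m -> A, b = psi (\sum_i alpha r * (e i * a i)).
have [||||||b [y [[e ->]]]] :=
    @stable_range_one _ B I0 (psi a0) ((phi s)^-1 *: psi d0) I.
- move=> y b /IP[e ->]; apply/IP; exists (fun i => y * e i).
  by rewrite mulr_sumr; apply: eq_bigr => i _; rewrite mulrA.
- apply/IP; exists (fun i => (phi s)^-1 *: psi (d i)).
  apply: (scalerI s0); rewrite scalerBr scalerAl scalerA divff // scale1r.
  rewrite -(rmorph1 psi) -psiZ mulr1 -das rmorphD rmorphM addrC addKr rmorph_sum scaler_sumr.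
  by apply: eq_bigr => i _; rewrite rmorphM scalerAl scalerA divff // scale1r.
- by exists (fun=> 0); rewrite big1 ?rmorph0 // => i _; rewrite mul0r mulr0.
- move=> _ _ [e ->] [e' ->]; exists (fun i => e i + e' i).
  rewrite -rmorphD -big_split; congr (psi _); apply: eq_bigr => i _ /=.
  by rewrite mulrDl mulrDr.
- move=> _ [e ->]; apply/IP; exists (fun i => psi (alpha r * e i)).
  by rewrite rmorph_sum; apply: eq_bigr => i _; rewrite mulrA rmorphM.
- move=> _ /IP[e ->]; have /choice[f /choice[t ft]] := fun i => psiW (e i).
  pose T := \prod_i t i; exists (phi (r * T)).
    (* [T] clears the denominators of the coefficients [e i], and [r] supplies the factor prescribed
       in [I0]. *)
    rewrite res_map_eq0 spec_mulF // spec_prodF // => i.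
    by have [] := ft i.
  exists (fun i => alpha (\prod_(j | j != i) t j) * f i).
  rewrite rmorph_sum scaler_sumr; apply: eq_bigr => i _.
  rewrite psiZ -mulrA psiZ rmorphM; have [_ <-] := ft i.
  rewrite -scalerAl !scalerA -!rmorphM; congr (phi _ *: _).
  by rewrite /T (bigD1 i) //=; ring.
rewrite -rmorphD => yE; have [z [t [pt ty]]] := psiW y.
exists e; apply: (@left_inv_mod _ z t) => //; apply: psi_inj.
rewrite rmorphB rmorphM -ty -scalerAl yE -[alpha t]mulr1 psiZ rmorph1.
by rewrite subrr.
Qed.

(** The transferred condition is applied to $c_0$ and $t_0/s$, for which $1-c_0t_0/s$ is $\sum_i
    c_it_i/s$. The factor [r] of the conclusion clears denominators. *)
Lemma stable_range_op_at (m : nat) (c t : 'I_m -> A) c0 t0 s :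
  s \notin p -> c0 * t0 + \sum_i c i * t i = alpha s ->
  exists2 r, r \notin p &
    exists e : 'I_m -> A, left_inv_at (alpha r * c0 + \sum_i c i * e i).
Proof.
move=> ps cts.
have [p1|/local_algebra[B [psi [psiZ psiW psi_inj]]]] :=
    pselect (in_locp 1).
  exists 1; first exact: spec1.
  exists (fun=> 0); apply: (@left_inv_mod _ 0 1); first exact: spec1.
  by rewrite mul0r sub0r rmorph1; apply: in_locpN.
have s0 : phi s != 0 by rewrite res_map_eq0.
have [b [y yE]] := stable_range_one_op (psi c0) ((phi s)^-1 *: psi t0).
have [b' [r [pr rb]]] := psiW b; have [y' [u [pu uy]]] := psiW y.
exists (s * r); first exact: spec_mulF.
exists (fun i => t i * b'); apply: (@left_inv_mod _ y' (u * s * r)).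
  by rewrite !spec_mulF.
apply: psi_inj; rewrite rmorphB rmorphM rmorphD psiZ.
have -> : psi (\sum_i c i * (t i * b')) =
    phi (s * r) *: ((1 - psi c0 * ((phi s)^-1 *: psi t0)) * b).
  rewrite rmorphM -scalerA scalerAr rb scalerAl scalerBr -scalerAr scalerA divff //.
  rewrite scale1r -(rmorph1 psi) -psiZ mulr1 -cts rmorphD rmorphM addrC addKr.
  by rewrite -rmorphM mulr_suml; congr (psi _); apply: eq_bigr => i _; rewrite mulrA.
rewrite -scalerDr -scalerAr -uy -scalerAl yE scalerA -rmorphM.
rewrite -[alpha (u * s * r)]mulr1 psiZ rmorph1 -scalerBl -rmorphB.
have -> : s * r * u - u * s * r = 0 by ring.
by rewrite rmorph0 scale0r.
Qed.

End LocalAlgebra.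

(** * Generators of modules at prime ideals *)

Section SpecOrder.
Context {R : comPzRingType}.
Implicit Types p q : Spec R.

Lemma spec_ext p q : (forall x, x \in p -> x \in q) ->
  (forall x, x \in q -> x \in p) -> p = q.
Proof.
case: p q => [p p1] [q q1] /= pq qp.
have E : p = q.
  by apply/funext => x; apply/idP/idP => H; [apply: (pq x) | apply: (qp x)].
by subst q; rewrite (Prop_irrelevance p1 q1).
Qed.

Definition spec_lt p q :=
  (forall x, x \in p -> x \in q) /\ exists2 x, x \in q & x \notin p.

Lemma spec_minimal (p0 : Spec R) (ps : seq (Spec R)) : exists2 p, p \in p0 :: ps &
  forall q, q \in p0 :: ps -> q != p -> exists2 x, x \in q & x \notin p.
Proof.
elim: ps p0 => [|p1 ps IHps] p0.
  by exists p0; rewrite ?mem_head // => q; rewrite inE => ->.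
have [p pin pmin] := IHps p1.
have [np|Np] := pselect (exists2 x, x \in p0 & x \notin p).
  exists p; rewrite ?inE in pin *; first by rewrite pin orbT.
  by move=> q; rewrite in_cons => /orP[/eqP -> //|]; apply: pmin.
have sub x : x \in p0 -> x \in p.
  by move=> p0x; apply: contraT => px; case: Np; exists x.
exists p0; rewrite ?mem_head // => q; rewrite in_cons => /predU1P[->|qin].
  by rewrite eqxx.
move=> qp0; apply: contrapT => Nq.
have sub' x : x \in q -> x \in p0.
  by move=> qx; apply: contraT => p0x; case: Nq; exists x.
have [qp|/(pmin q qin)[x qx]] := eqVneq q p; last by rewrite sub // sub'.
by case/eqP: qp0; apply: spec_ext => // x /sub; rewrite qp.
Qed.

Lemma spec_avoid p (qs : seq (Spec R)) :
  (forall q, q \in qs -> exists2 x, x \in q & x \notin p) ->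
  exists2 r, r \notin p & forall q, q \in qs -> r \in q.
Proof.
elim: qs => [|q qs IHqs] H; first by exists 1; rewrite ?spec1.
have [|r pr rqs] := IHqs; first by move=> q' q'in; apply: H; rewrite inE q'in orbT.
have [x qx px] := H q (mem_head _ _).
exists (x * r); first exact: spec_mulF.
by move=> q'; rewrite inE => /predU1P[->|/rqs]; [apply: specMl | apply: specMr].
Qed.

End SpecOrder.

Section Generators.
Context {R : comPzRingType} {A : pzRingType} (alpha : algebra R A).
Context {l : nat} (g : 'I_l -> A).
Hypothesis gP : forall x, exists c : 'I_l -> R, x = \sum_i alpha (c i) * g i.
Context {Q : lmodType A}.
Implicit Types (P : Q -> Prop) (u v q : Q) (p : Spec R) (r s t : R).

Definition adjoin P v : Q -> Prop := fun q => exists a : A, P (q - a *: v).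

Lemma submodule_adjoin P v : submodule P -> submodule (adjoin P v).
Proof.
move=> sP; split; first by exists 0; rewrite scale0r subr0; apply: submodule0.
move=> a u w [b Pb] [c Pc]; exists (a * b + c).
rewrite scalerDl opprD addrACA -scalerA -scalerBr; case: sP => _; exact.
Qed.

Lemma adjoin_sub P v q : P q -> adjoin P v q.
Proof. by exists 0; rewrite scale0r subr0. Qed.

Lemma adjoin_id P v : submodule P -> adjoin P v v.
Proof. by exists 1; rewrite scale1r subrr; apply: submodule0. Qed.

Lemma scale_alg_comm (a : A) r q : a *: (alpha r *: q) = alpha r *: (a *: q).
Proof. by rewrite !scalerA alg_mapC. Qed.

(** The image of [q] lies in the $A_p$-span of [z] in $(Q/P)_p$. *)
Definition in_span P p m (z : 'I_m -> Q) q := exists2 s, s \notin p &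
  exists c : 'I_m -> A, P (alpha s *: q - \sum_i c i *: z i).

Lemma submodule_in_span P p m (z : 'I_m -> Q) :
  submodule P -> submodule (in_span P p z).
Proof.
move=> sP; split.
  exists 1; first exact: spec1.
  exists (fun=> 0); rewrite scaler0 big1 ?subr0; first exact: submodule0.
  by move=> i _; rewrite scale0r.
move=> a u v [s ps [c cP]] [t pt [d dP]]; exists (s * t); first exact: spec_mulF.
exists (fun i => a * (alpha t * c i) + alpha s * d i).
have H := submoduleD sP (submoduleZ (a * alpha t) sP cP)
  (submoduleZ (alpha s) sP dP).
apply: (eq_ind _ P H) => {H}.
rewrite !scalerBr addrACA -opprD !scaler_sumr -big_split /=; congr (_ - _).
  rewrite scalerDr !scalerA -rmorphM; congr (_ *: _ + _).
  by rewrite -mulrA -rmorphM [t * s]mulrC alg_mapC.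
by apply: eq_bigr => i _; rewrite scalerDl !scalerA mulrA.
Qed.

Lemma in_span_div P p m (z : 'I_m -> Q) s q : s \notin p ->
  in_span P p z (alpha s *: q) -> in_span P p z q.
Proof.
move=> ps [t pt [c cP]]; exists (t * s); first exact: spec_mulF.
by exists c; rewrite rmorphM -scalerA.
Qed.

Lemma in_span_sub P p m (z : 'I_m -> Q) q : submodule P -> P q -> in_span P p z q.
Proof.
move=> sP Pq; exists 1; first exact: spec1.
exists (fun=> 0); rewrite rmorph1 scale1r big1 ?subr0 // => i _.
by rewrite scale0r.
Qed.

Lemma in_span_id P p m (z : 'I_m -> Q) i : submodule P -> in_span P p z (z i).
Proof.
move=> sP; exists 1; first exact: spec1.
exists (fun j => (i == j)%:R); rewrite rmorph1 scale1r (bigD1 i) //=.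
rewrite eqxx scale1r big1 ?addr0 ?subrr; first exact: submodule0.
by move=> j; rewrite eq_sym => /negPf ->; rewrite scale0r.
Qed.

(** A single [s] serves for all [q]. Thus the primes where [m] elements do not suffice are those
    that contain every such [s], a closed condition. *)
Definition spans_with P m (z : 'I_m -> Q) s :=
  forall q, exists c : 'I_m -> A, P (alpha s *: q - \sum_i c i *: z i).

Definition generated_at P p m :=
  exists (z : 'I_m -> Q) s, s \notin p /\ spans_with P z s.

Lemma spans_trans P P' p n (v : 'I_n -> Q) m (z : 'I_m -> Q) s :
  submodule P' -> (forall q, P q -> P' q) -> s \notin p -> spans_with P v s ->
  (forall i, in_span P' p z (v i)) -> generated_at P' p m.
Proof.
move=> sP' PP' ps vP vz; exists z.
have /choice[t tP] : forall i, exists t, t \notin p /\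
    exists c : 'I_m -> A, P' (alpha t *: v i - \sum_j c j *: z j).
  by move=> i; have [t pt [c cP]] := vz i; exists t; split=> //; exists c.
pose T := \prod_i t i; exists (T * s); split.
  by rewrite spec_mulF // spec_prodF // => i; have [] := tP i.
have /choice[c cP] : forall i, exists c : 'I_m -> A,
    P' (alpha T *: v i - \sum_j c j *: z j).
  move=> i; have [_ [c cP]] := tP i; pose T' := \prod_(j | j != i) t j.
  exists (fun j => alpha T' * c j).
  have H := submoduleZ (alpha T') sP' cP; apply: (eq_ind _ P' H).
  rewrite scalerBr scaler_sumr scalerA -rmorphM [T' * _]mulrC /T (bigD1 i) //=.
  by congr (_ - _); apply: eq_bigr => j _; rewrite scalerA.
move=> q; have [d dP] := vP q; exists (fun j => \sum_i d i * c i j).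
have H := submoduleD sP' (submoduleZ (alpha T) sP' (PP' _ dP))
  (submodule_sum sP' (fun i => submoduleZ (d i) sP' (cP i))).
apply: (eq_ind _ P' H) => {H}.
rewrite scalerBr scalerA -rmorphM -addrA; congr (_ + _).
under [X in _ + X = _]eq_bigr do rewrite scalerBr.
rewrite sumrB addrA scaler_sumr.
under eq_bigr do rewrite -scale_alg_comm.
rewrite addNr sub0r; congr (- _).
under eq_bigr do rewrite scaler_sumr.
rewrite exchange_big /=; apply: eq_bigr => j _; rewrite scaler_suml.
by apply: eq_bigr => i _; rewrite scalerA.
Qed.

Lemma generated_at_sub P P' p m : submodule P' -> (forall q, P q -> P' q) ->
  generated_at P p m -> generated_at P' p m.
Proof.
move=> sP' PP' [z [s [ps zP]]]; apply: spans_trans ps zP _ => // i.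
exact: in_span_id.
Qed.

Definition cons_gen m (u : Q) (z : 'I_m -> Q) (i : 'I_m.+1) : Q :=
  oapp z u (unlift ord0 i).

Lemma generated_atS P p m : submodule P ->
  generated_at P p m -> generated_at P p m.+1.
Proof.
move=> sP [z [s [ps zP]]].
apply: (spans_trans (z := cons_gen 0 z) (P := P) (P' := P) sP) ps zP _ => // i.
have -> : z i = cons_gen 0 z (lift ord0 i) by rewrite /cons_gen liftK.
exact: in_span_id.
Qed.

Lemma generated_at_leq P p m m' : submodule P -> (m <= m')%N ->
  generated_at P p m -> generated_at P p m'.
Proof.
move=> sP /subnK <-; elim: (m' - m)%N => // k IHk /IHk.
by rewrite addSn; apply: generated_atS.
Qed.

Lemma generated_at_relation P p m (T : {linear Q -> A^o}) (c : Q) s :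
  submodule P -> (forall q, P q -> T q = 0) -> s \notin p -> T c = alpha s ->
  generated_at P p m -> generated_at (adjoin P c) p m.-1.
Proof.
move=> sP TP ps Tc [z [t [pt zP]]]; have [a aP] := zP c.
have sP' := submodule_adjoin c sP.
have Ta : \sum_i a i * (T (z i) : A) = alpha (t * s).
  have := TP _ aP; rewrite linearB /= linearZ /= Tc linear_sum => /subr0_eq H.
  rewrite rmorphM; transitivity (\sum_i T (a i *: z i)) => //.
  by apply: eq_bigr => i _; rewrite linearZ.
case: m => [|m] in z zP a aP Ta *.
  (* With no generators the sum in [Ta] is empty, so [t * s] acts as zero on $Q$. *)
  exists z, (t * s); split; first exact: spec_mulF.
  move=> q; exists (fun=> 0); rewrite -Ta !big_ord0 scale0r subr0.
  exact: submodule0.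
rewrite (bigD1_ord ord0) //= in Ta.
have [r pr [e [y [s1 [ps1 yE]]]]] := stable_range_op_at gP (spec_mulF pt ps) Ta.
pose z' i := alpha r *: z (lift ord0 i) - e i *: z ord0.
have sW := submodule_in_span p z' sP'.
have Wz' i : in_span (adjoin P c) p z' (z' i) by apply: in_span_id.
have Waz : in_span (adjoin P c) p z' (\sum_i a i *: z i).
  apply: in_span_sub => //; exists (alpha t).
  by rewrite -opprB; apply: submoduleN.
have Wz0 : in_span (adjoin P c) p z' (z ord0).
  apply: (in_span_div ps1); rewrite -yE -scalerA; apply: submoduleZ => //.
  have -> : (alpha r * a ord0 + \sum_i a (lift ord0 i) * e i) *: z ord0 =
      alpha r *: (\sum_i a i *: z i) - \sum_i a (lift ord0 i) *: z' i.
    rewrite (bigD1_ord ord0) //= scalerDr scalerDl scalerA -addrA; congr (_ + _).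
    rewrite scaler_suml scaler_sumr -sumrB; apply: eq_bigr => i _.
    by rewrite /z' scalerBr opprB scale_alg_comm -scalerA addrC subrK.
  apply: submoduleB => //; first exact: submoduleZ.
  by apply: submodule_sum => // i; apply: submoduleZ.
apply: (spans_trans (z := z')) pt zP _ => // [q Pq|i]; first exact: adjoin_sub.
case: (unliftP ord0 i) => [j|] -> //.
apply: (in_span_div pr); rewrite -(subrK (e j *: z ord0) (alpha r *: _)).
by apply: (submoduleD sW (Wz' j)); apply: (submoduleZ _ sW).
Qed.

(** The [c k] are killed one at a time: [T k] vanishes on the span [C k] of the earlier ones and is
    invertible on [c k], so each of them saves one generator. *)
Lemma generated_at_relations P p n (y : 'I_n -> Q) m
    (T : 'I_m -> {linear Q -> A^o}) (c : 'I_m -> Q) (s : 'I_m -> R) :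
  submodule P -> (forall q, exists b : 'I_n -> A, q = \sum_i b i *: y i) ->
  (forall i, P (c i)) -> (forall i, s i \notin p) ->
  (forall i j, T i (c j) = if i == j then alpha (s j) else 0) ->
  generated_at P p (n - m).
Proof.
move=> sP yP Pc ps Tc.
pose C k q := exists b : 'I_m -> A,
  (forall i : 'I_m, (k <= i)%N -> b i = 0) /\ q = \sum_i b i *: c i.
have sC k : submodule (C k).
  split; first by exists (fun=> 0); split=> //; rewrite big1 // => i _; rewrite scale0r.
  move=> a _ _ [b [b0 ->]] [b' [b'0 ->]]; exists (fun i => a * b i + b' i); split.
    by move=> i ki; rewrite b0 // b'0 // mulr0 addr0.
  rewrite scaler_sumr -big_split; apply: eq_bigr => i _ /=.
  by rewrite scalerDl scalerA.
have genC k : (k <= m)%N -> generated_at (C k) p (n - k).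
  elim: k => [_|k IHk km].
    rewrite subn0; exists y, 1; split; first exact: spec1.
    move=> q; have [b ->] := yP q; exists b.
    by rewrite rmorph1 scale1r subrr; apply: submodule0.
  have Tk q : C k q -> T (Ordinal km) q = 0.
    move=> [b [b0 ->]]; rewrite linear_sum big1 // => i _.
    rewrite linearZ /= Tc; case: eqP => [<-|_]; last by rewrite scaler0.
    by rewrite b0 // scale0r.
  have Tck : T (Ordinal km) (c (Ordinal km)) = alpha (s (Ordinal km)).
    by rewrite Tc eqxx.
  rewrite subnS.
  apply: generated_at_sub (generated_at_relation (sC k) Tk (ps _) Tck (IHk (ltnW km))) => //.
  move=> q [a [b [b0 qE]]]; exists (fun i => b i + (if i == Ordinal km then a else 0)).
  split=> [i ki|].
    rewrite b0 ?(ltnW ki) //; case: eqP => [iE|_]; last by rewrite addr0.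
    by move: ki; rewrite iE /= ltnn.
  rewrite -(subrK (a *: c (Ordinal km)) q) qE.
  under [RHS]eq_bigr do rewrite scalerDl.
  rewrite big_split /=; congr (_ + _).
  rewrite (bigD1 (Ordinal km)) //= eqxx big1 ?addr0 // => i /negPf ->.
  by rewrite scale0r.
apply: generated_at_sub (genC m (leqnn m)) => // q [b [_ ->]].
by apply: submodule_sum => // i; apply: submoduleZ.
Qed.

(** Stable range one is to make the coefficient of $z_0$ in $\xi$ left invertible. Since [z] need
    not be a basis, these coefficients are unimodular only up to an error [c0]; but $c_0z_0$ lies in
    the span of the other $z_j$, so [c0] may enter the column as an extra entry and its contribution
    be discarded. *)
Lemma generated_at_cut P p n (y0 : Q) (y : 'I_n -> Q) m r : submodule P ->
  (forall q, exists b0 b, P (q - (b0 *: y0 + \sum_i b i *: y i))) ->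
  r \notin p -> generated_at P p m.+1 ->
  exists e : 'I_n -> A,
    generated_at (adjoin P (y0 + alpha r *: \sum_i e i *: y i)) p m.
Proof.
move=> sP yP pr [z [s [ps zP]]].
have [a0 a0P] := zP y0; have /choice[a aP] := fun i => zP (y i).
have [d0 [d dP]] := yP (z ord0).
pose c0 := alpha s - (d0 * a0 ord0 + \sum_i d i * a i ord0).
pose a' (i : 'I_n.+1) := oapp (fun j => a j ord0) c0 (unlift ord0 i).
pose d' (i : 'I_n.+1) := oapp d 1 (unlift ord0 i).
have [|e' [x [s1 [ps1 xE]]]] :=
    @stable_range_at _ _ alpha p _ g gP _ a' d' (a0 ord0) d0 r s pr ps.
  rewrite (bigD1_ord ord0) //= /a' /d' unlift_none mul1r addrCA.
  under eq_bigr do rewrite liftK.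
  by rewrite /= /c0 subrK.
pose e i := e' (lift ord0 i); exists e.
set xi := _ + _; have sP' := submodule_adjoin xi sP.
pose z' i := z (lift ord0 i); pose W := in_span (adjoin P xi) p z'.
have sW : submodule W := submodule_in_span p z' sP'.
have WP q : P q -> W q by move=> Pq; apply: in_span_sub => //; apply: adjoin_sub.
have Wz' i : W (z (lift ord0 i)) by apply: (in_span_id p z' i sP').
have Wdecomp (b : 'I_m.+1 -> A) q : P (q - \sum_i b i *: z i) ->
    W (q - b ord0 *: z ord0).
  move=> /WP H; rewrite -(subrK (\sum_i b i *: z i) q) -addrA.
  apply: (submoduleD sW) => //; rewrite (bigD1_ord ord0) //= addrC addKr.
  by apply: (submodule_sum sW) => i; apply: (submoduleZ _ sW).
have Wy0 := Wdecomp _ _ a0P; have Wy i := Wdecomp _ _ (aP i).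
have Wc0 : W (c0 *: z ord0).
  have H1 := submoduleZ (alpha s) sW (WP _ dP).
  have H2 := submoduleZ d0 sW Wy0.
  have H3 := submodule_sum sW (fun i => submoduleZ (d i) sW (Wy i)).
  have H := submoduleD sW H1 (submoduleD sW H2 H3).
  apply: (eq_ind _ W H) => {H H1 H2 H3}.
  have -> : \sum_i d i *: (alpha s *: y i - a i ord0 *: z ord0) =
      \sum_i d i *: (alpha s *: y i) - (\sum_i d i * a i ord0) *: z ord0.
    rewrite scaler_suml -sumrB; apply: eq_bigr => i _.
    by rewrite scalerBr -scalerA.
  rewrite [X in _ + (X + _)]scalerBr [X in _ + X]addrACA -opprD addrA scalerBr.
  have -> : d0 *: (alpha s *: y0) + \sum_i d i *: (alpha s *: y i) =
      alpha s *: (d0 *: y0 + \sum_i d i *: y i).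
    rewrite scalerDr scaler_sumr scale_alg_comm; congr (_ + _).
    by apply: eq_bigr => i _; rewrite scale_alg_comm.
  by rewrite subrK /c0 scalerBl scalerDl scalerA.
have Wxi : W (alpha s *: xi).
  by apply/(submoduleZ _ sW)/in_span_sub => //; apply: adjoin_id.
have Wz0 : W (z ord0).
  apply: (in_span_div ps1); rewrite -xE -scalerA; apply: (submoduleZ _ sW).
  have H3 := submodule_sum sW (fun i => submoduleZ (alpha r * e i) sW (Wy i)).
  have H4 := submoduleZ (alpha r * e' ord0) sW Wc0.
  have H := submoduleD sW (submoduleB sW Wxi (submoduleD sW Wy0 H3)) H4.
  apply: (eq_ind _ W H) => {H H3 H4}.
  have -> : alpha s *: xi = alpha s *: y0 +
      \sum_i (alpha r * e i) *: (alpha s *: y i).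
    rewrite /xi scalerDr !scaler_sumr; congr (_ + _); apply: eq_bigr => i _.
    by rewrite [in RHS]scale_alg_comm -scalerA.
  have -> : \sum_i (alpha r * e i) *: (alpha s *: y i - a i ord0 *: z ord0) =
      \sum_i (alpha r * e i) *: (alpha s *: y i)
      - (\sum_i alpha r * (e i * a i ord0)) *: z ord0.
    rewrite scaler_suml -sumrB; apply: eq_bigr => i _.
    by rewrite scalerBr [X in _ - X]scalerA mulrA.
  rewrite [X in _ - X + _]addrACA -opprD opprB addrCA subrr addr0.
  rewrite (bigD1_ord ord0) //= /a' unlift_none.
  under [in RHS]eq_bigr do rewrite liftK.
  by rewrite scalerA -!scalerDl mulrA -addrA [X in _ + X]addrC.
apply: (spans_trans (z := z')) ps zP _ => // [q Pq|i]; first exact: adjoin_sub.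
by case: (unliftP ord0 i) => [j|] ->; [apply: Wz' | apply: Wz0].
Qed.

(** A cut for the least number of generators serves all larger [m]. If that least number is zero, or
    if none exists, any [e] will do. *)
Lemma generated_at_cut_all P p n (y0 : Q) (y : 'I_n -> Q) r : submodule P ->
  (forall q, exists b0 b, P (q - (b0 *: y0 + \sum_i b i *: y i))) ->
  r \notin p ->
  exists e : 'I_n -> A, forall m, generated_at P p m.+1 ->
    generated_at (adjoin P (y0 + alpha r *: \sum_i e i *: y i)) p m.
Proof.
move=> sP yP pr; have [P0|nP0] := pselect (generated_at P p 0).
  exists (fun=> 0) => m _.
  apply: (generated_at_leq (m := 0)) => //; first exact: submodule_adjoin.
  apply: generated_at_sub P0; first exact: submodule_adjoin.
  by move=> q; apply: adjoin_sub.
have [[m Pm]|/forallNP nP] := pselect (exists m, generated_at P p m); last first.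
  by exists (fun=> 0) => m /nP.
pose D m := `[< generated_at P p m >].
have exD : exists m, D m by exists m; apply/asboolP.
case: (ex_minnP exD) => -[|k] /asboolP // Pk kmin.
have [e eP] := generated_at_cut sP yP pr Pk; exists e => m' /asboolP/kmin km'.
by apply: generated_at_leq eP => //; apply: submodule_adjoin.
Qed.

(** The change of [xi] lies in $pQ$, so [z] still generates modulo $pQ$, and Nakayama's lemma
    concludes. *)
Lemma generated_at_perturb P p N (v : 'I_N -> Q) xi eta r m : submodule P ->
  (forall q, exists c : 'I_N -> R, P (q - \sum_i alpha (c i) *: v i)) ->
  r \in p -> generated_at (adjoin P xi) p m ->
  generated_at (adjoin P (xi + alpha r *: eta)) p m.
Proof.
move=> sP vP pr [z [s [ps zP]]].
pose P' := adjoin P (xi + alpha r *: eta); pose W := in_span P' p z.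
have sP' : submodule P' := submodule_adjoin _ sP.
have sW : submodule W := submodule_in_span p z sP'.
have WP q : P q -> W q by move=> Pq; apply: in_span_sub => //; apply: adjoin_sub.
have Wz i : W (z i) by apply: in_span_id.
have [i|t pt tP] := @nakayama _ _ alpha p Q W sW N v s ps.
  have [c [a aP]] := zP (v i); have [d dP] := vP (a *: eta).
  exists (fun j => - (r * d j)); split=> [j|].
    by rewrite specN // specMl.
  have Wxi : W (a *: (xi + alpha r *: eta)).
    by apply/(submoduleZ _ sW)/in_span_sub => //; apply: adjoin_id.
  have H := submoduleD sW (submoduleB sW (submoduleD sW (WP _ aP)
    (submodule_sum sW (fun j => submoduleZ (c j) sW (Wz j))))
    (submoduleZ (alpha r) sW (WP _ dP))) Wxi.
  apply: (eq_ind _ W H) => {H}.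
  rewrite [X in _ - X]scalerBr scaler_sumr scalerDr scale_alg_comm.
  move: (alpha s *: v i) (\sum_i c i *: z i) (a *: xi) => x1 x2 x3.
  move: (alpha r *: (a *: eta)) => x4.
  have -> : \sum_i alpha (- (r * d i)) *: v i =
      - \sum_i alpha r *: (alpha (d i) *: v i).
    rewrite -sumrN; apply: eq_bigr => j _.
    by rewrite rmorphN rmorphM scaleNr scalerA.
  move: (\sum_i _) => x5.
  by rewrite opprK opprB [x1 - x2 - x3]addrAC subrK addrACA !subrK.
apply: (@spans_trans P' P' p N v m z 1) => //; first exact: spec1.
  move=> q; have [c cP] := vP q; exists (fun i => alpha (c i)).
  by rewrite rmorph1 scale1r; apply: adjoin_sub.
by move=> i; apply: (in_span_div pt); apply: tP.
Qed.

Lemma scalar_generators P n (y : 'I_n -> Q) : submodule P ->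
  (forall q, exists c : 'I_n -> A, P (q - \sum_i c i *: y i)) ->
  exists N (v : 'I_N -> Q),
    forall q, exists c : 'I_N -> R, P (q - \sum_i alpha (c i) *: v i).
Proof.
move=> sP yP; pose I := ('I_n * 'I_l)%type.
exists #|{: I}|, (fun k => g (enum_val k).2 *: y (enum_val k).1) => q.
have [c cP] := yP q; have /choice[d dP] := fun i => gP (c i).
exists (fun k => d (enum_val k).1 (enum_val k).2).
apply: (eq_ind _ P cP); congr (_ - _).
rewrite -(big_enum_val (fun k : I => alpha (d k.1 k.2) *: (g k.2 *: y k.1))) /=.
rewrite -(pair_bigA _ (fun i j => alpha (d i j) *: (g j *: y i))) /=.
apply: eq_bigr => i _; rewrite {1}dP scaler_suml.
by apply: eq_bigr => j _; rewrite scalerA.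
Qed.

(** A minimal prime of the list is treated last. As it contains none of the others, some [r] outside
    it lies in all of them, and a correction divisible by [r] preserves the cuts already made. *)
Lemma generated_at_cut_seq P n (y0 : Q) (y : 'I_n -> Q) (ps : seq (Spec R)) :
  submodule P ->
  (forall q, exists b0 b, P (q - (b0 *: y0 + \sum_i b i *: y i))) ->
  exists e : 'I_n -> A, forall p, p \in ps -> forall m, generated_at P p m.+1 ->
    generated_at (adjoin P (y0 + \sum_i e i *: y i)) p m.
Proof.
move=> sP yP; have [k] := ubnP (size ps); elim: k ps => // k IHk ps.
case: ps => [|p0 ps] lek; first by exists (fun=> 0).
have [p pin pmin] := spec_minimal p0 ps.
pose qs := [seq q <- p0 :: ps | q != p].
have [|e eP] := IHk qs.
  rewrite -ltnS; apply: leq_trans lek; rewrite ltnS size_filter.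
  rewrite -(count_predC (predC1 p) (p0 :: ps)) -addn1 leq_add2l -has_count.
  by apply/hasP; exists p; rewrite //= negbK.
have [q|r pr rqs] := @spec_avoid R p qs.
  by rewrite mem_filter => /andP[qp /pmin]; apply.
set y0' := y0 + _ in eP.
have yP' q : exists b0 b, P (q - (b0 *: y0' + \sum_i b i *: y i)).
  have [b0 [b bP]] := yP q; exists b0, (fun i => b i - b0 * e i).
  apply: (eq_ind _ P bP); congr (_ - _).
  rewrite /y0' scalerDr -addrA; congr (_ + _).
  rewrite scaler_sumr -big_split; apply: eq_bigr => i _ /=.
  by rewrite scalerBl scalerA addrC subrK.
have [e' e'P] := generated_at_cut_all sP yP' pr.
have [N [v vP]] : exists N (v : 'I_N -> Q),
    forall q, exists c : 'I_N -> R, P (q - \sum_i alpha (c i) *: v i).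
  apply: (@scalar_generators P n.+1 (cons_gen y0 y)) => // q.
  have [b0 [b bP]] := yP q; exists (fun i => oapp b b0 (unlift ord0 i)).
  apply: (eq_ind _ P bP); congr (_ - _).
  rewrite (bigD1_ord ord0) //= /cons_gen !unlift_none; congr (_ + _).
  by apply: eq_bigr => i _; rewrite liftK.
exists (fun i => e i + alpha r * e' i) => q qin m Pq.
have -> : y0 + \sum_i (e i + alpha r * e' i) *: y i =
    y0' + alpha r *: \sum_i e' i *: y i.
  rewrite /y0' -addrA; congr (_ + _); rewrite scaler_sumr -big_split.
  by apply: eq_bigr => i _; rewrite /= scalerDl scalerA.
case: (eqVneq q p) => [qE|qp]; first by rewrite qE in Pq *; apply: e'P.
have qqs : q \in qs by rewrite mem_filter qp.
by apply: generated_at_perturb vP _ _ => //; [apply: rqs | apply: eP].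
Qed.

Section Swan.
Variable X : Spec R -> Prop.
Hypothesis X_max : forall I : R -> Prop, I 0 ->
  (forall a x x', I x -> I x' -> I (a * x + x')) -> ~ I 1 ->
  (forall r, alpha r = 0 -> I r) -> exists2 p, X p & forall r, I r -> r \in p.
Hypothesis X_min : forall T : R -> Prop, exists ps : seq (Spec R),
  forall p, X p -> (forall r, T r -> r \in p) ->
    (forall p', X p' -> (forall r, T r -> r \in p') -> ~ spec_lt p' p) -> p \in ps.

(** A chain of length [k] going up from [p] in [X], so that $\dim_X(p)$ is at least [k]. *)
Fixpoint has_chain k p : Prop :=
  if k is k'.+1 then exists p', [/\ X p', spec_lt p p' & has_chain k' p'] else True.

(* The two conditions on [b] say that Q is generated, modulo [P], by
   the combinations of [y] on which the functional [c |-> c b] vanishes: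
   these are generated by elements [y i + sum_(j < i) e i j y j], [i > 0]. *)
Lemma general_position P n (y : 'I_n.+1 -> Q) : submodule P ->
  (forall q, exists c, P (q - \sum_i c i *: y i)) ->
  (forall p, X p -> forall k, (k <= n)%N -> has_chain k p ->
     generated_at P p (n - k)) ->
  exists b : 'I_n.+1 -> A, b ord0 = 1 /\
    forall q, exists c, P (q - \sum_i c i *: y i) /\ \sum_i c i * b i = 0.
Proof.
elim: n P y => [|n IHn] P y sP yP XP.
  exists (fun=> 1); split=> // q; exists (fun=> 0); split; last first.
    by rewrite big1 // => i _; rewrite mul0r.
  rewrite big1 ?subr0 => [|i _]; last by rewrite scale0r.
  (* For $n=0$ the hypothesis says that $Q/P$ vanishes at every prime of [X]. Its annihilator [I]
     then lies in no such prime, so it is the unit ideal. *)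
  pose I r := forall q, P (alpha r *: q).
  suff I1 : I 1 by have := I1 q; rewrite rmorph1 scale1r.
  apply: contrapT => nI1; have [|||p Xp pI] := X_max _ _ nI1.
  - by move=> u; rewrite rmorph0 scale0r; apply: submodule0.
  - move=> a r r' Ir Ir' u; rewrite rmorphD rmorphM scalerDl -scalerA.
    by case: sP => _; apply.
  - by move=> r r0 u; rewrite r0 scale0r; apply: submodule0.
  have [z [s [ps zP]]] := XP p Xp 0%N isT Logic.I.
  case/negP: ps; apply: pI => u; have [c] := zP u.
  by rewrite big_ord0 subr0.
pose y0 := y ord_max; pose y' i := y (lift ord_max i).
(* The zeros of [T k] are the primes where [k] generators do not suffice; [ps k] contains the
   minimal ones in [X]. *)
pose T k r := exists z : 'I_k -> Q, spans_with P z r.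
have /choice[ps psP] := fun k => X_min (T k).
have [|e eP] := @generated_at_cut_seq P n.+1 y0 y' (flatten (map ps (iota 0 n.+1))) sP.
  move=> q; have [c cP] := yP q; exists (c ord_max), (fun i => c (lift ord_max i)).
  by move: cP; rewrite (bigD1_ord ord_max).
set xi := _ + _ in eP; have sP' := submodule_adjoin xi sP.
have [|p Xp k kn pk|b' [b'0 b'P]] := IHn (adjoin P xi) y' sP'.
- move=> q; have [c cP] := yP q.
  exists (fun i => c (lift ord_max i) - c ord_max * e i), (c ord_max).
  apply: (eq_ind _ P cP); rewrite (bigD1_ord ord_max) //= /xi scalerDr.
  rewrite -addrA -opprD addrCA; congr (_ - (_ + _)).
  rewrite scaler_sumr -big_split; apply: eq_bigr => i _ /=.
  by rewrite scalerBl scalerA subrK.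
- have [Pk|nPk] := pselect (generated_at P p (n - k)).
    by apply: generated_at_sub Pk => // q; apply: adjoin_sub.
  apply: eP; last by rewrite -subSn //; apply: XP => //; apply: leqW.
  apply/flatten_mapP; exists (n - k)%N; first by rewrite mem_iota add0n ltnS leq_subr.
  have Tsub (q : Spec R) : ~ generated_at P q (n - k) -> forall r, T (n - k)%N r -> r \in q.
    move=> nq r [z zP]; apply: contraT => qr; case: nq.
    by exists z, r.
  (* Here [p] is minimal in its locus: a smaller prime [q] of [X] has a chain of length [k.+1], so
     $(n+1)-(k+1)=n-k$ generators already suffice there. *)
  apply: psP => // [|q Xq Tq pq]; first exact: Tsub.
  have : generated_at P q (n.+1 - k.+1) by apply: XP => //; exists p.
  rewrite subSS => -[z [s [qs zP]]]; case/negP: qs; apply: Tq.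
  by exists z.
(* The last value is chosen so that the functional vanishes on [xi]. *)
exists (fun i => oapp b' (- \sum_j e j * b' j) (unlift ord_max i)); split.
  have -> : ord0 = lift ord_max ord0 :> 'I_n.+2.
    by apply: ord_inj; rewrite lift_max.
  by rewrite liftK.
move=> q; have [c [[a aP] cb]] := b'P q.
exists (fun i => oapp (fun j => c j + a * e j) a (unlift ord_max i)); split.
  apply: (eq_ind _ P aP); rewrite -addrA -opprD; congr (_ - _).
  rewrite [in RHS](bigD1_ord ord_max) //= unlift_none /=.
  under [in RHS]eq_bigr do rewrite liftK /= scalerDl.
  rewrite big_split /= addrCA; congr (_ + _); rewrite /xi scalerDr; congr (_ + _).
  by rewrite scaler_sumr; apply: eq_bigr => i _; rewrite scalerA.
rewrite (bigD1_ord ord_max) //= unlift_none /=.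
under [X in _ + X = _]eq_bigr do rewrite liftK /= mulrDl -mulrA.
by rewrite big_split /= cb add0r mulrN -mulr_sumr addNr.
Qed.

End Swan.

End Generators.

(** * Prime ideals and Krull dimension *)

Section MaximalIdeals.
Local Open Scope classical_set_scope.
Context {R : comPzRingType}.
Implicit Types I J : set R.

Definition set_ideal I := I 0 /\ forall a x y, I x -> I y -> I (a * x + y).

Lemma exists_maximal_ideal I : set_ideal I -> ~ I 1 ->
  exists2 m : R -> bool, maximal_ideal m & forall x, I x -> x \in m.
Proof.
(* The union with [I] lets the empty set, the union of the empty chain, satisfy [P]. *)
move=> [I0 IM] I1; pose P J := set_ideal (J `|` I) /\ ~ (J `|` I) 1.
have [|A [[[A0 AM] A1] Amax]] := @Zorn_bigcup R P.
  move=> F FP totF; split; last first.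
    by move=> [[J FJ J1]|//]; have [_] := FP _ FJ; apply; left.
  have sub J : F J -> J `|` I `<=` \bigcup_(J in F) J `|` I.
    by move=> FJ x [Jx|Ix]; [left; exists J | right].
  have mulIJ a x y J : F J -> (J `|` I) x -> (J `|` I) y ->
      (\bigcup_(J in F) J `|` I) (a * x + y).
    by move=> FJ Jx Jy; apply: (sub _ FJ); have [[_ JM] _] := FP _ FJ; apply: JM.
  split=> [|a x y]; first by right.
  move=> [[J FJ Jx]|Ix] [[J' FJ' Jy]|Iy].
  - have [JJ'|J'J] := totF _ _ FJ FJ'.
      by apply: (mulIJ _ _ _ _ FJ'); left => //; apply: JJ'.
    by apply: (mulIJ _ _ _ _ FJ); left => //; apply: J'J.
  - by apply: (mulIJ _ _ _ _ FJ); [left | right].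
  - by apply: (mulIJ _ _ _ _ FJ'); [right | left].
  - by right; apply: IM.
pose m x := `[< (A `|` I) x >].
have mP x : x \in (m : {pred R}) <-> (A `|` I) x by split=> /asboolP.
exists m => [|x Ix]; last by apply/mP; right.
split.
- split; first exact/mP.
  by move=> a x y /mP Ax /mP Ay; apply/mP/AM.
- by apply/negP => /mP.
- move=> J [J0 JM] J1 mJ x; apply/idP/idP => [Jx|]; last exact: mJ.
  have AJ y : (A `|` I) y -> y \in J by move=> Ay; apply/mJ/mP.
  have AJI : [set y | y \in J] `|` I = [set y | y \in J].
    by apply/seteqP; split=> y /=; [case=> // Iy; apply: AJ; right | left].
  have PJ : P [set y | y \in J].
    rewrite /P AJI; split; last exact/negP.
    by split=> // a y z /= Jy Jz; apply: JM.
  apply/mP; left; apply: contrapT => Ax.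
  apply: (Amax [set y | y \in J]) => //; split; first by move=> y Ay; apply: AJ; left.
  by move=> /(_ _ Jx).
Qed.

Lemma maximal_ideal_prime (m : R -> bool) :
  maximal_ideal m -> prime_ideal (m : {pred R}).
Proof.
case=> -[m0 mM] m1 mmax; split; [by split | by [] | move=> x y xy; apply/orP].
have [mx|mx] := boolP (x \in (m : {pred R})); [by left | right].
pose J : {pred R} := fun z => `[< exists a b, b \in (m : {pred R}) /\ z = a * x + b >].
have JP z : z \in J <-> exists a b, b \in (m : {pred R}) /\ z = a * x + b.
  by split=> /asboolP.
have [J1|J1] := boolP (1 \in J).
  have [a [b [mb ab1]]] := iffLR (JP _) J1.
  have -> : y = a * (x * y) + (y * b + 0).
    by rewrite addr0 mulrA [y * b]mulrC -mulrDl -ab1 mul1r.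
  by rewrite mM ?mM.
have xJ : x \in J by apply/JP; exists 1, 0; rewrite mul1r addr0.
case/negP: mx; rewrite -(mmax J) //.
  split; first by apply/JP; exists 0, 0; rewrite mul0r addr0.
  move=> c _ _ /JP[a [b [mb ->]]] /JP[a' [b' [mb' ->]]]; apply/JP.
  exists (c * a + a'), (c * b + b'); split; first exact: mM.
  by ring.
move=> z mz; apply/JP; exists 0, z; split=> //.
by rewrite mul0r add0r.
Qed.

End MaximalIdeals.

Section Spectra.
Local Open Scope classical_set_scope.
Context {R : comPzRingType}.
Implicit Types (X : set (Spec R)) (T : set R).

Lemma closed_set_typeP (T : topologicalType) (X : set T) (C : set (set_type X)) :
  closed C <-> exists2 D, closed D & C = set_val @^-1` D.
Proof.
split=> [|[D cD ->]]; last first.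
  rewrite -openC preimage_setC; exists (~` D) => //; exact: closed_openC.
rewrite -openC => -[U oU UC]; exists (~` U); first exact: open_closedC.
by rewrite -preimage_setC UC setCK.
Qed.

Lemma closed_vanishing T : closed (vanishing T : set (Spec R)).
Proof. by rewrite -openC; exists T. Qed.

Lemma closed_specP (D : set (Spec R)) : closed D -> exists T, D = vanishing T.
Proof. by rewrite -openC => -[T TD]; exists T; apply: setC_inj. Qed.

Section NoetherianSubspace.
Variable X : set (Spec R).
Hypothesis noethX : noetherian_space (set_type X).
Hypothesis X_bigcap : forall (Z : set (Spec R)) (p : Spec R), Z `<=` X ->
  (forall x, x \in p <-> forall q, Z q -> x \in q) -> X p.

Let zeros T : set (Spec R) := X `&` vanishing T.

Let covered T := exists ps : seq (Spec R),
  forall q, zeros T q -> exists2 p, p \in ps & zeros T p /\ forall x, x \in p -> x \in q.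

(** Let [I] be the ideal of all elements that vanish on [zeros T]. If [x * y] is in [I] but neither
    factor is, the zeros split into two smaller closed sets, which cannot both be covered. If [I] is
    prime, then as an intersection of points of [X] it is itself in [X], and it covers [zeros T]
    alone. *)
Lemma not_covered_shrink T : ~ covered T ->
  exists2 T', ~ covered T' & zeros T' `<` zeros T.
Proof.
move=> nT; pose I : set R := [set x | forall q, zeros T q -> x \in q].
have [[x [y [Ixy Ix Iy]]]|Iprime] :=
    pselect (exists x y, [/\ I (x * y), ~ I x & ~ I y]).
  have Tz z : zeros (T `|` [set z]) = [set q | zeros T q /\ z \in q].
    apply/seteqP; split=> q /=.
      move=> [Xq Tq]; split; last by apply: Tq; right.
      by split=> // r Tr; apply: Tq; left.
    by move=> [[Xq Tq] zq]; split=> // r [Tr|->] //; apply: Tq.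
  have sub z : ~ I z -> zeros (T `|` [set z]) `<` zeros T.
    move=> Iz; rewrite Tz; split=> [q []//|H]; apply: Iz => q Zq.
    by have [] := H q Zq.
  have [[ps psP]|cx] := pselect (covered (T `|` [set x])); last first.
    by exists (T `|` [set x]) => //; apply: sub.
  have [[qs qsP]|cy] := pselect (covered (T `|` [set y])); last first.
    by exists (T `|` [set y]) => //; apply: sub.
  case: nT; exists (ps ++ qs) => q Zq; have := Ixy q Zq.
  rewrite spec_mul => /orP[xq|yq].
    have [|p pin [Zp pq]] := psP q; first by rewrite Tz.
    by exists p; rewrite ?mem_cat ?pin //; move: Zp; rewrite Tz => -[].
  have [|p pin [Zp pq]] := qsP q; first by rewrite Tz.
  by exists p; rewrite ?mem_cat ?pin ?orbT //; move: Zp; rewrite Tz => -[].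
have [q0 Zq0] : exists q0, zeros T q0.
  by apply: contrapT => /forallNP Z0; apply: nT; exists [::] => q /Z0.
have IP : prime_ideal ((fun x => `[< I x >]) : {pred R}).
  split.
  - split; first by apply/asboolP => q _; apply: spec0.
    move=> a u v /asboolP Iu /asboolP Iv; apply/asboolP => q Zq.
    by rewrite specD ?specMr ?Iu ?Iv.
  - by apply/negP => /asboolP/(_ _ Zq0); apply/negP/spec1.
  - move=> u v /asboolP Iuv; apply/orP; apply: contrapT => /not_orP[nu nv].
    by apply: Iprime; exists u, v; split=> // H; [apply: nu | apply: nv]; apply/asboolP.
pose p := PrimeSpec IP.
have pI x : x \in p <-> I x by split=> /asboolP.
have Xp : X p by apply: (X_bigcap (Z := zeros T)) => // q [].
case: nT; exists [:: p] => q Zq; exists p; rewrite ?mem_head //; split.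
  by split=> // r Tr; apply/pI => q' [_]; apply.
by move=> x /pI; apply.
Qed.

Lemma all_covered T : covered T.
Proof.
apply: contrapT => nT; case: noethX.
have /choice[f fP] (T' : {T' : set R | ~ covered T'}) :
    exists T'' : {T' | ~ covered T'}, zeros (sval T'') `<` zeros (sval T').
  by have [T'' nT'' lt] := not_covered_shrink (svalP T'); exists (exist _ T'' nT'').
pose F n := iter n f (exist _ T nT).
exists (fun n => set_val @^-1` vanishing (sval (F n))); split=> n.
  by apply/closed_set_typeP; exists (vanishing (sval (F n))) => //; apply: closed_vanishing.
have [sub nsub] := fP (F n); split.
  by move=> q /= Tq; case: (sub (val q) (conj (set_mem (valP q)) Tq)).
move=> H; apply: nsub => q [Xq Tq]; split=> //.
exact: (H (exist _ q (mem_set Xq))).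
Qed.

Lemma finite_minimal_primes (T : R -> Prop) : exists ps : seq (Spec R),
  forall p, X p -> (forall r, T r -> r \in p) ->
    (forall q, X q -> (forall r, T r -> r \in q) -> ~ spec_lt q p) -> p \in ps.
Proof.
have [ps psP] := all_covered T; exists ps => p Xp Tp pmin.
have [q qin [[Xq Tq] qp]] := psP p (conj Xp Tp).
suff -> : p = q by [].
apply: spec_ext => // x px; apply: contrapT => /negP qx.
by apply: (pmin q Xq Tq); split=> //; exists x.
Qed.

End NoetherianSubspace.

Section ChainsOfPrimes.
Variable X : set (Spec R).

Lemma has_chain_sequence k p : X p -> has_chain X k p ->
  exists f : nat -> Spec R, [/\ f 0%N = p, forall i, (i <= k)%N -> X (f i)
    & forall i, (i < k)%N -> spec_lt (f i) (f i.+1)].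
Proof.
elim: k p => [|k IHk] p Xp /=; first by exists (fun=> p); split=> // i.
move=> [q [Xq pq /(IHk _ Xq)[f [f0 fX fS]]]].
exists (fun i => if i is j.+1 then f j else p); split=> // -[|i] //.
- exact: fX.
- by rewrite f0.
- exact: fS.
Qed.

Lemma closed_point_closureP (p : set_type X) (C : set (point_closure p)) :
  closed C <->
  exists T, C = set_val @^-1` (set_val @^-1` (vanishing T : set (Spec R))).
Proof.
split=> [/closed_set_typeP[D cD ->]|[T ->]].
  have [E cE ->] := iffLR (closed_set_typeP _) cD.
  by have [T ->] := closed_specP cE; exists T.
apply/closed_set_typeP; eexists; last reflexivity.
by apply/closed_set_typeP; eexists; last reflexivity; apply: closed_vanishing.
Qed.

(** Each prime of the chain is a generic point of its zero set in the closure of [p], which is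
    therefore irreducible. Larger primes have smaller zero sets, hence the index [k - i]. *)
Lemma has_chain_irr (p : set_type X) k :
  has_chain X k (val p) -> has_irr_chain (point_closure p) k.
Proof.
move=> /(has_chain_sequence (set_mem (valP p)))[f [f0 fX fS]].
have f_sub i j : (i <= j <= k)%N -> forall x, x \in f i -> x \in f j.
  case/andP; elim: j => [|j IHj]; first by rewrite leqn0 => /eqP ->.
  rewrite leq_eqVlt => /predU1P[-> //|ij] jk x fx.
  by have [sub _] := fS _ jk; apply: sub; apply: IHj => //; apply: ltnW.
have cl (q : set_type X) : (forall x, x \in val p -> x \in val q) ->
    (closure [set p] : set (set_type X)) q.
  move=> pq; rewrite closureE => C [/closed_set_typeP[D cD ->] pC].
  have [T TD] := closed_specP cD; rewrite TD in pC *.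
  by move=> x Tx; apply: pq; apply: (pC p erefl).
have c_ex (i : 'I_k.+1) : exists c : point_closure p, val (val c) = f (k - i)%N.
  have Xf : X (f (k - i)%N) by apply: fX; apply: leq_subr.
  pose q : set_type X := exist (fun q => q \in X) _ (mem_set Xf).
  have clq : (closure [set p] : set (set_type X)) q.
    by apply: cl => x; rewrite -f0; apply: f_sub; rewrite leq_subr.
  by exists (exist (fun q' => q' \in closure [set p]) q (mem_set clq)).
have [c cE] := choice c_ex.
exists (fun i => set_val @^-1` (set_val @^-1`
  (vanishing [set x | x \in f (k - i)%N] : set (Spec R)))).
split=> [i|i j ij].
  split; first by apply/closed_point_closureP; eexists.
  split; first by exists (c i) => x /=; rewrite -cE.
  move=> _ _ /closed_point_closureP[T ->] /closed_point_closureP[T' ->] sub.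
  have [Tc|Tc] : (c i \in set_val @^-1` (set_val @^-1` (vanishing T : set (Spec R))))
      \/ (c i \in set_val @^-1` (set_val @^-1` (vanishing T' : set (Spec R)))).
  - have [|Tc|Tc] := sub (c i); first by move=> x /=; rewrite -cE.
      by left; apply: mem_set.
    by right; apply: mem_set.
  - left=> z Cz x Tx; apply: Cz; rewrite /= -cE.
    exact: (set_mem Tc).
  - right=> z Cz x Tx; apply: Cz; rewrite /= -cE.
    exact: (set_mem Tc).
have kij : (k - j < k - i)%N by apply: ltn_sub2l => //; rewrite (leq_trans ij) // -ltnS.
split=> [z Cz x fx|].
  by apply: Cz => /=; apply: f_sub fx; rewrite ltnW // leq_subr.
move=> /(_ (c j)) H; have [sub [x fx nfx]] : spec_lt (f (k - j)%N) (f (k - j).+1).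
  by apply: fS; apply: leq_trans kij (leq_subr _ _).
case/negP: nfx; rewrite -cE; apply: H => [y /=|]; first by rewrite -cE.
by move: fx; apply: f_sub; rewrite kij leq_subr.
Qed.

End ChainsOfPrimes.
End Spectra.

(** * Localized homomorphisms *)

Section Localizations.
Context {R : comPzRingType} {S : pzRingType} (alpha : algebra R S).
Implicit Types (M N : lmodType S^c) (p : Spec R) (r s t : R).
Local Notation "r %:S" := (alpha r : S^c) (at level 2, format "r %:S").

Lemma scale_alg_prod N (I : finType) (f : I -> R) (i : I) (x : N) :
  (\prod_j f j)%:S *: x = (\prod_(j | j != i) f j)%:S *: ((f i)%:S *: x).
Proof. by rewrite (bigD1 i) //= rmorphM scale_convM. Qed.

Lemma scale_algM N r s (x : N) : (r * s)%:S *: x = r%:S *: (s%:S *: x).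
Proof. by rewrite mulrC rmorphM scale_convM. Qed.

Lemma finitely_presented_gen N : finitely_presented N ->
  exists n (x : 'I_n -> N), forall y,
    exists c : 'I_n -> S^c, y = \sum_i c i *: x i.
Proof.
move=> [m [n [u [v [v_surj _]]]]].
exists n, (fun i => v (delta_mx 0 i)) => y; have [z <-] := v_surj y.
exists (fun i => z 0 i); rewrite {1}(row_sum_delta z) linear_sum.
by apply: eq_bigr => i _; rewrite linearZ.
Qed.

Section GeneratedModule.
Context {N : lmodType S^c} {n : nat} {x : 'I_n -> N}.
Hypothesis xP : forall y, exists c : 'I_n -> S^c, y = \sum_i c i *: x i.

Lemma linear_eq_gen {M : lmodType S^c} (f g : {linear N -> M}) :
  (forall i, f (x i) = g (x i)) -> f =1 g.
Proof.
move=> fg y; have [c ->] := xP y; rewrite !linear_sum; apply: eq_bigr => i _.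
by rewrite !linearZ fg.
Qed.

Lemma SuppP p :
  Supp alpha N p <-> forall r, (forall y : N, r%:S *: y = 0) -> r \in p.
Proof.
split=> [[z z0] r r0|H].
  apply: contraT => pr; case: z0; have [y [s ->]] := mfracW z.
  apply/mfracP; exists (exist _ r pr) => /=.
  by rewrite mulr1 r0 scaler0.
apply: contrapT => /forallNP N0.
have /choice[u uP] : forall i, exists u : denom p, (sval u)%:S *: x i = 0.
  move=> i; have /contrapT/mfracP[u] := N0 (mfrac alpha (x i) (denom_one p)).
  by rewrite /= mulr1 scaler0; exists u.
have : \prod_i sval (u i) \in p.
  apply: H => y; have [c ->] := xP y; rewrite scaler_sumr big1 // => i _.
  by rewrite -scale_algC (scale_alg_prod _ i) uP !scaler0.
by apply/negP/spec_prodF => i; apply: svalP (u i).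
Qed.

End GeneratedModule.

Section LocalMaps.
Variable p : Spec R.

(* M_p as an S-module, so that the maps x |-> x / 1 and their composites with
   S_p-linear maps become linear. *)
Definition loc_restr M : Type := locMod p alpha M.

Section Restriction.
Context {M : lmodType S^c}.
HB.instance Definition _ := GRing.Zmodule.on (loc_restr M).

Definition restr_scale (a : S^c) (z : loc_restr M) : loc_restr M :=
  (sfrac alpha a (denom_one p) : (locRing p alpha)^c) *: (z : locMod p alpha M).

Lemma restr_scaleE a (x : M) (d : denom p) :
  restr_scale a (mfrac alpha x d) = mfrac alpha (a *: x) d.
Proof.
rewrite /restr_scale mfrac_scale; apply/mfracP; exists (denom_one p) => /=.
by rewrite !mul1r.
Qed.

Fact restr_scaleA a b z :
  restr_scale a (restr_scale b z) = restr_scale (a * b) z.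
Proof.
by have [x [d ->]] := mfracW z; rewrite !restr_scaleE scalerA.
Qed.
Fact restr_scale1 : left_id 1 restr_scale.
Proof. by move=> z; have [x [d ->]] := mfracW z; rewrite restr_scaleE scale1r. Qed.
Fact restr_scaleDr : right_distributive restr_scale +%R.
Proof. by move=> a z z'; apply: scalerDr. Qed.
Fact restr_scaleDl z : {morph restr_scale^~ z : a b / a + b}.
Proof.
move=> a b; have [x [d ->]] := mfracW z; rewrite !restr_scaleE scalerDl.
by rewrite [RHS](frac_addl (V := rmod alpha M)).
Qed.
HB.instance Definition _ := GRing.Zmodule_isLmodule.Build S^c (loc_restr M)
  restr_scaleA restr_scale1 restr_scaleDr restr_scaleDl.

Definition loc1 (x : M) : loc_restr M := mfrac alpha x (denom_one p).

Fact loc1_is_linear : linear loc1.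
Proof.
move=> a x y; have E : a *: loc1 x = loc1 (a *: x) := restr_scaleE a x _.
by rewrite E [RHS](frac_addl (V := rmod alpha M)).
Qed.
HB.instance Definition _ := GRing.isLinear.Build S^c M (loc_restr M) *:%R loc1
  loc1_is_linear.

Lemma loc1_eq0 (x : M) : loc1 x = 0 -> exists2 r, r \notin p & r%:S *: x = 0.
Proof.
move=> /mfracP[u]; rewrite /= mulr1 scaler0 => ux; exists (sval u) => //.
exact: svalP u.
Qed.

Lemma loc1W (z : loc_restr M) :
  exists x r, r \notin p /\ r%:S *: z = loc1 x.
Proof.
have [x [d ->]] := mfracW z; exists x, (sval d); split; first exact: svalP d.
rewrite [LHS]restr_scaleE; apply/mfracP; exists (denom_one p).
by rewrite /= mulr1 !mul1r rmorph1 scale1r.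
Qed.

End Restriction.

(** Clearing denominators lifts [G] to a map on the free cover of [N]. It sends the finitely many
    relations to elements that vanish in $M_p$, so one further factor [T] kills them and the map
    descends to [N]. *)
Lemma lift_local_map M N (G : {linear N -> loc_restr M}) :
  finitely_presented N ->
  exists (k : {linear N -> M}) r, r \notin p /\
    forall x, loc1 (k x) = r%:S *: G x.
Proof.
move=> [m [n [u [v [v_surj uv]]]]].
have row_gen q (y : 'rV[S^c]_q) : y = \sum_i y 0 i *: delta_mx 0 i.
  exact: row_sum_delta.
have /choice[w /choice[s sP]] := fun i => loc1W (G (v (delta_mx 0 i))).
pose w' i := (\prod_(j | j != i) s j)%:S *: w i.
pose k0 (y : 'rV[S^c]_n) := \sum_i y 0 i *: w' i.
have k0_lin : linear k0.
  move=> a y y'; rewrite /k0 scaler_sumr -big_split; apply: eq_bigr => i _ /=.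
  by rewrite !mxE scalerDl scalerA.
pose k1 : {linear 'rV[S^c]_n -> M} := HB.pack k0
  (GRing.isLinear.Build _ _ _ _ k0 k0_lin).
have k1E y : loc1 (k1 y) = (\prod_i s i)%:S *: G (v y).
  rewrite {2}(row_gen _ y) !linear_sum /= scaler_sumr; apply: eq_bigr => i _.
  rewrite !linearZ /= -scale_algC; congr (_ *: _).
  by rewrite (scale_alg_prod _ i); have [_ ->] := sP i.
have /choice[t tP] : forall i, exists t, t \notin p /\
    t%:S *: k1 (u (delta_mx 0 i)) = 0.
  move=> i; have [|t pt tk] := @loc1_eq0 M (k1 (u (delta_mx 0 i))).
    by rewrite k1E (iffRL (uv _)) ?linear0 ?scaler0 //; exists (delta_mx 0 i).
  by exists t.
pose T := \prod_i t i.
have ku z : T%:S *: k1 (u z) = 0.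
  rewrite (row_gen _ z) !linear_sum scaler_sumr big1 // => i _.
  rewrite !linearZ /= -scale_algC (scale_alg_prod _ i).
  by have [_ ->] := tP i; rewrite !scaler0.
have /choice[h hP] := v_surj.
pose k2 x := T%:S *: k1 (h x).
have kv y : T%:S *: k1 y = k2 (v y).
  apply/eqP; rewrite -subr_eq0 -scalerBr -linearB; apply/eqP.
  have [|z <-] := iffLR (uv (y - h (v y))); last exact: ku.
  by rewrite linearB hP subrr.
have k2_lin : linear k2.
  move=> a x y; rewrite -{1}[x]hP -{1}[y]hP -linearP -kv linearP.
  by rewrite scalerDr -scale_algC.
pose k : {linear N -> M} := HB.pack k2 (GRing.isLinear.Build _ _ _ _ k2 k2_lin).
exists k, (T * \prod_i s i); split.
  by rewrite spec_mulF // spec_prodF // => i; [have [] := tP i | have [] := sP i].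
by move=> x; rewrite /= /k2 linearZ /= k1E hP scale_algM.
Qed.

Lemma split_surjection_lift M N (F : {pred {linear M -> N}}) m :
  finitely_presented N -> has_split_surjection p alpha F m ->
  exists (f : 'I_m -> {linear M -> N}) (k : 'I_m -> {linear N -> M})
      (s : 'I_m -> R),
    [/\ forall i, f i \in F, forall i, s i \notin p
      & forall i j x, f i (k j x) = if i == j then (s j)%:S *: x else 0].
Proof.
move=> fpN [h [/choice[f /choice[d fdP]] [g gK]]].
pose G0 j (x : N) : loc_restr M := g [ffun i => if i == j then loc1 x else 0].
have G0_lin j : linear (G0 j).
  move=> a x y; rewrite /G0.
  rewrite -[RHS](linearP g (sfrac alpha a (denom_one p) : (locRing p alpha)^c)).
  congr (g _); apply/ffunP => i; rewrite !ffunE.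
  by case: eqP => _; [exact: (linearP (@loc1 N)) | rewrite scaler0 addr0].
pose G j : {linear N -> loc_restr M} :=
  HB.pack (G0 j) (GRing.isLinear.Build _ _ _ _ (G0 j) (G0_lin j)).
have /choice[k /choice[t ktP]] := fun j => lift_local_map (G j) fpN.
have [n [x xP]] := finitely_presented_gen fpN.
have /choice[U UP] : forall ijl : 'I_m * 'I_m * 'I_n, exists U, U \notin p /\
    U%:S *: f ijl.1.1 (k ijl.1.2 (x ijl.2)) =
    (U * sval (d ijl.1.1))%:S *: (if ijl.1.1 == ijl.1.2
       then (t ijl.1.2)%:S *: x ijl.2 else 0).
  move=> [[i j] l] /=; have [pt ktE] := ktP j.
  have E : loc_hom (h i) (loc1 (k j (x l))) =
      loc1 (if i == j then (t j)%:S *: x l else 0).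
    have gKi z : loc_hom (h i) (g z) = z i.
      by rewrite -[in RHS](gK z) [RHS]ffunE.
    transitivity (restr_scale (t j)%:S (loc_hom (h i) (G j (x l)))).
      rewrite ktE; exact: linearZ.
    rewrite /= /G0 gKi ffunE; case: eqP => _; first exact: restr_scaleE.
    by rewrite linear0; apply: scaler0.
  have [_ hE] := fdP i; move: E; rewrite hE [LHS]loc_hom_funE => /mfracP[u].
  rewrite /= !mulr1 => uE; exists (sval u); split=> //; exact: svalP u.
(* Each identity holds only after multiplication by its [U], on one generator of [N]; the product
   makes all of them hold at once. *)
pose T := \prod_ijl U ijl.
pose k' j : {linear N -> M} := (homothety alpha T : {linear M -> M}) \o k j.
pose s j := T * sval (d j) * t j.
exists f, k', s; split=> [i|i|i j].
- by have [] := fdP i.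
- have [pt _] := ktP i; rewrite !spec_mulF //; last exact: svalP (d i).
  by apply: spec_prodF => ijl; have [] := UP ijl.
pose D : {linear N -> N} := if i == j then homothety alpha (s j) : {linear N -> N} else 0.
move=> y; transitivity (D y); last by rewrite /D; case: (i == j).
apply: (linear_eq_gen xP (f := f i \o k' j)) => l; rewrite /= /homothety linearZ /=.
have [_ E] := UP (i, j, l); rewrite (scale_alg_prod _ (i, j, l)) E /= /D.
case: eqP => [ij|_]; last by rewrite !scaler0.
rewrite /= /homothety /s /T [in RHS](bigD1 (i, j, l)) //= -!scale_algM ij.
by congr ((alpha _ : S^c) *: _); ring.
Qed.

End LocalMaps.
End Localizations.

(** * Cancellation *)

Section Isomorphisms.
Context {A : pzRingType}.
Implicit Types U V W N L M : lmodType A.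

Definition mk_linear U V (f : U -> V) (f_lin : linear f) : {linear U -> V} :=
  HB.pack f (GRing.isLinear.Build _ _ _ _ f f_lin).

Lemma isomorphic_inv U V : isomorphic U V ->
  exists (f : {linear U -> V}) (g : {linear V -> U}), cancel f g /\ cancel g f.
Proof.
move=> [f [g fK gK]].
have g_lin : linear g by move=> a x y; apply: (can_inj fK); rewrite gK linearP !gK.
by exists f, (mk_linear g_lin).
Qed.

Lemma isomorphic_of_linear U V (f : U -> V) (g : V -> U) :
  linear f -> cancel f g -> cancel g f -> isomorphic U V.
Proof.
by move=> f_lin fK gK; exists (mk_linear f_lin), g.
Qed.

Lemma isomorphic_sym U V : isomorphic U V -> isomorphic V U.
Proof. by move=> /isomorphic_inv[f [g [fK gK]]]; exists g, f. Qed.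

Lemma isomorphic_trans V U W : isomorphic U V -> isomorphic V W -> isomorphic U W.
Proof.
by move=> [f f_bij] [g g_bij]; exists (g \o f); apply: bij_comp.
Qed.

Lemma isomorphic_prod2l U V W : isomorphic V W -> isomorphic (U * V)%type (U * W)%type.
Proof.
move=> /isomorphic_inv[f [g [fK gK]]].
apply: (isomorphic_of_linear (f := fun z => (z.1, f z.2)) (g := fun z => (z.1, g z.2))).
- by move=> a [x y] [x' y']; congr (_, _); rewrite /= linearP.
- by move=> [x y] /=; rewrite fK.
- by move=> [x y] /=; rewrite gK.
Qed.

Lemma isomorphic_prodC U V : isomorphic (U * V)%type (V * U)%type.
Proof.
apply: (isomorphic_of_linear (f := fun z => (z.2, z.1)) (g := fun z => (z.2, z.1))).
- by move=> a [x y] [x' y'].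
- by case.
- by case.
Qed.

Lemma isomorphic_prodA U V W :
  isomorphic (U * (V * W))%type (U * V * W)%type.
Proof.
apply: (isomorphic_of_linear (f := fun z => (z.1, z.2.1, z.2.2))
  (g := fun z => (z.1.1, (z.1.2, z.2)))).
- by move=> a [x [y z]] [x' [y' z']].
- by move=> [x [y z]].
- by move=> [[x y] z].
Qed.

Lemma isomorphic_ffun0 U V : isomorphic U ({ffun 'I_0 -> V} * U)%type.
Proof.
apply: (isomorphic_of_linear (f := fun x => (0, x)) (g := snd)).
- by move=> a x y; congr (_, _); rewrite /= scaler0 addr0.
- by [].
- by move=> [v x]; congr (_, _); apply/ffunP => -[].
Qed.

Lemma isomorphic_ffunS n V :
  isomorphic {ffun 'I_n.+1 -> V} (V * {ffun 'I_n -> V})%type.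
Proof.
apply: (isomorphic_of_linear
  (f := fun v : {ffun 'I_n.+1 -> V} => (v ord0, [ffun i => v (lift ord0 i)]))
  (g := fun z => [ffun i => oapp z.2 z.1 (unlift ord0 i)])).
- move=> a v w; congr (_, _); first by rewrite !ffunE.
  by apply/ffunP => i; rewrite !ffunE.
- move=> v; apply/ffunP => i; rewrite ffunE /=.
  by case: unliftP => [j ->|->] //=; rewrite ffunE.
- move=> [x v]; rewrite /= ffunE unlift_none; congr (_, _).
  by apply/ffunP => i; rewrite !ffunE liftK.
Qed.

Lemma linear_sumE U V (I : finType) (f : I -> {linear U -> V}) x :
  (\sum_i f i) x = \sum_i f i x.
Proof.
exact: (big_morph (fun h : {linear U -> V} => h x) (fun _ _ => erefl) erefl).
Qed.

(* The kernel of (a, g) : N + M -> N is a complement of a copy of N; composing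
   with elementary automorphisms of N + M turns (a, g) into (a, g + a f), then
   into (1, g + a f), and then into (1, 0), whose kernel is M. *)
Lemma cancellation_of_shift N L M :
  (forall (a b : {linear N -> N}) (g : {linear M -> N}) (h : {linear N -> M}),
     (forall x, a (b x) + g (h x) = x) ->
     exists (f : {linear M -> N}) (k : {linear N -> M}),
       forall x, g (k x) + a (f (k x)) = x) ->
  isomorphic (N * L)%type (N * M)%type -> isomorphic L M.
Proof.
move=> shift /isomorphic_inv[t [t' [tK t'K]]].
have lin1 V W (x y : V) (z z' : W) c :
  ((c *: x + y, c *: z + z') : V * W) = c *: (x, z) + (y, z') by [].
have a_lin : linear (fun x : N => (t' (x, 0)).1).
  by move=> c x y; rewrite -(linearP (fst : {linear _ -> _})) -linearP -lin1 scaler0 addr0.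
have b_lin : linear (fun x : N => (t (x, 0)).1).
  by move=> c x y; rewrite -(linearP (fst : {linear _ -> _})) -linearP -lin1 scaler0 addr0.
have h_lin : linear (fun x : N => (t (x, 0)).2).
  by move=> c x y; rewrite -(linearP (snd : {linear _ -> _})) -linearP -lin1 scaler0 addr0.
have g_lin : linear (fun y : M => (t' (0, y)).1).
  by move=> c x y; rewrite -(linearP (fst : {linear _ -> _})) -linearP -lin1 scaler0 addr0.
pose a := mk_linear a_lin.
pose b := mk_linear b_lin.
pose h := mk_linear h_lin.
pose g := mk_linear g_lin.
have t'1 x y : (t' (x, y)).1 = a x + g y.
  rewrite -[RHS](raddfD (fst : {linear _ -> _})) -raddfD; congr (t' _).1.
  by congr (_, _); rewrite /= ?addr0 ?add0r.
have [|f [k fk]] := shift a b g h.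
  by move=> x; rewrite -t'1 -surjective_pairing tK.
clear b h b_lin h_lin; clearbody a g.
pose g' y := g y + a (f y).
have g'B y z : g' (y - z) = g' y - g' z by rewrite /g' !linearB addrACA opprD.
have g'k x : g' (k x) = x := fk x.
(* [D] is the first coordinate after the shear that turns $(a,g)$ into $(a,g')$. Subtracting
   $k(D-aD)$ from the second then turns $a$ into 1, because $g'k=1$. On the kernel this gives
   $D=-g'\psi$, from which [y2] and [F2] recover the element. *)
pose D (z : N * M) := z.1 - f z.2.
pose psi (z : N * M) := z.2 - k (D z - a (D z)).
have linB V (c : A) (x y x' y' : V) :
    c *: x + y - (c *: x' + y') = c *: (x - x') + (y - y').
  by rewrite opprD addrACA scalerBr.
have D_lin c z w : D (c *: z + w) = c *: D z + D w.
  by rewrite /D /= linearP linB.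
have psi_lin : linear psi.
  by move=> c z w; rewrite /psi D_lin (linearP a) linB (linearP k) linB.
pose y2 y := y - k (g' y - a (g' y)).
pose F1 (l : L) := psi (t (0, l)).
pose F2 y := (t' (f (y2 y) - g' y, y2 y)).2.
apply: (isomorphic_of_linear (f := F1) (g := F2)).
- by move=> c x y; rewrite /F1 -psi_lin -linearP -lin1 scaler0 addr0.
- move=> l; rewrite /F1 /F2.
  case tE : (t (0, l)) => [u v].
  have t'uv : t' (u, v) = (0, l) by rewrite -tE tK.
  have uv : a u + g v = 0 by rewrite -t'1 t'uv.
  rewrite /psi /D /=; set x := u - f v; set y := v - _.
  have ax : a x + g' v = 0.
    by rewrite /x linearB /g' [g v + _]addrC addrA subrK.
  have g'y : g' y = - x.
    by rewrite /y g'B g'k opprB addrA [g' v + _]addrC ax sub0r.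
  have -> : y2 y = v.
    rewrite /y2 g'y linearN opprK (_ : - x + a x = - (x - a x)); last by rewrite [RHS]opprB addrC.
    by rewrite linearN opprK subrK.
  by rewrite g'y opprK addrC /x subrK t'uv.
- move=> y; rewrite /F1 /F2; pose z := (f (y2 y) - g' y, y2 y); rewrite -/z.
  have z1 : (t' z).1 = 0.
    rewrite /z t'1 linearB addrAC [a (f _) + _]addrC -/(g' (y2 y)).
    by rewrite /y2 g'B g'k opprB addrCA subrr addr0 subrr.
  have -> : (0, (t' z).2) = t' z by rewrite -z1 -surjective_pairing.
  rewrite t'K /psi /D /z /= [f _ - _ - _]addrAC subrr sub0r linearN opprK.
  rewrite /y2 (_ : - g' y + a (g' y) = - (g' y - a (g' y))) ?linearN ?opprK ?subrK //.
  by rewrite opprB addrC.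
Qed.

End Isomorphisms.

Section Cancellation.
Context {R : comPzRingType} {S : pzRingType} (alpha : algebra R S).
Context (N : lmodType S^c).
Hypothesis noethN : noetherian_space (set_type (jSupp alpha N)).
Hypothesis fpN : finitely_presented N.
Hypothesis mfN : module_finite (end_alg alpha N).
Implicit Types (L M : lmodType S^c) (p : Spec R).
Local Notation A := (Endo N)^c.
Local Notation X := (jSupp alpha N).

Fact end_op_is_monoid : monoid_morphism (fun r => end_alg alpha N r : A).
Proof.
by split=> [|r s]; rewrite ?rmorph1 // rmorphM alg_mapC.
Qed.
Fact end_op_is_zmod : zmod_morphism (fun r => end_alg alpha N r : A).
Proof. by move=> r s; rewrite rmorphB. Qed.

Definition end_op : algebra R A :=
  @Algebra R A (HB.pack (fun r => end_alg alpha N r : A)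
    (GRing.isZmodMorphism.Build R A _ end_op_is_zmod)
    (GRing.isMonoidMorphism.Build R A _ end_op_is_monoid))
    (fun r f => esym (alg_mapC (end_alg alpha N) r f)).

Lemma end_op_gen : exists l (g : 'I_l -> A), forall x,
  exists c : 'I_l -> R, x = \sum_i end_op (c i) * g i.
Proof.
have [l [g [_ gP]]] := mfN; exists l, g => x.
have [|c cE] := gP x; first by [].
exists c; rewrite {1}cE; apply: eq_bigr => i _.
exact: (alg_mapC (end_alg alpha N)).
Qed.

Lemma Supp_end_op p : Supp alpha N p <-> forall r, end_op r = 0 -> r \in p.
Proof.
have [n [x xP]] := finitely_presented_gen fpN; rewrite (SuppP alpha xP).
split=> H r r0; apply: H.
  by move=> y; apply: (congr1 (fun f : {linear N -> N} => f y) r0).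
by apply: lin_ext => y; apply: r0.
Qed.

Lemma jSupp_max (I : R -> Prop) : I 0 ->
  (forall a x x', I x -> I x' -> I (a * x + x')) -> ~ I 1 ->
  (forall r, end_op r = 0 -> I r) -> exists2 p, X p & forall r, I r -> r \in p.
Proof.
move=> I0 IM I1 IN; have [//|m max_m Im] := @exists_maximal_ideal _ I _ I1.
exists (PrimeSpec (maximal_ideal_prime max_m)); last exact: Im.
split; last by apply/Supp_end_op => r /IN/Im.
exists [set m]%classic; split=> [_ ->//|x].
by split=> [mx _ ->|]; last exact.
Qed.

(** The maximal ideals above some member of [Z] intersect in [p], as each member is an intersection
    of maximal ideals. *)
Lemma jSupp_bigcap (Z : set (Spec R)) p : (Z `<=` X)%classic ->
  (forall x, x \in p <-> forall q, Z q -> x \in q) -> X p.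
Proof.
move=> ZX pZ; split; last first.
  apply/Supp_end_op => r r0; apply/pZ => q /ZX[_ /Supp_end_op]; exact.
exists [set m : R -> bool | exists2 q, Z q &
  maximal_ideal (m : {pred R}) /\ forall x, x \in q -> m x]%classic.
split=> [m [q _ []]//|x]; split=> [/pZ px m [q Zq [_ qm]]|H].
  exact/qm/px.
apply/pZ => q Zq; have [[Ms [Ms_max qMs]] _] := ZX q Zq.
apply/qMs => m Msm; apply: H; exists q => //; split; first exact: Ms_max.
by move=> y /qMs; apply.
Qed.

(* The condition (3) of the theorem, with the localizations unfolded: the [T i]
   are the coordinates of [k + 1] elements of the module generated by [F]. *)
Definition splits M n (F : 'I_n -> {linear M -> N}) := forall p, X p ->
  forall k, has_chain X k p ->
  exists (T : 'I_k.+1 -> 'I_n -> {linear N -> N}) (h : 'I_k.+1 -> {linear N -> M})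
      (s : 'I_k.+1 -> R), (forall i, s i \notin p) /\
    forall i j x, \sum_l T i l (F l (h j x)) =
      if i == j then (alpha (s j) : S^c) *: x else 0.

Lemma unimodular_shift M n (F : 'I_n -> {linear M -> N}) : splits F ->
  forall (a b : {linear N -> N}) (g : {linear M -> N}) (h : {linear N -> M}),
    (forall x, a (b x) + g (h x) = x) ->
  exists (f : {linear M -> N}) (k : {linear N -> M}),
    forall x, g (k x) + a (f (k x)) = x.
Proof.
move=> splF a b g h abgh; have [l [gen genP]] := end_op_gen.
pose Q := 'rV[A]_n.+1.
pose w (k : {linear N -> M}) : Q :=
  \row_j (if unlift ord0 j is Some i then F i \o k : {linear N -> N}
          else g \o k : {linear N -> N}).
pose P (q : Q) := exists k, q = w k.
have w_lin (c : A) k k' : c *: w k + w k' =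
    w ((k \o (c : {linear N -> N}) : {linear N -> M}) + k').
  apply/rowP => j; rewrite !mxE; apply: lin_ext => x.
  by case: (unlift ord0 j) => [i|] /=; rewrite [RHS]linearD.
have sP : submodule P.
  split=> [|c _ _ [k ->] [k' ->]]; last by rewrite w_lin; eexists.
  exists 0; apply/rowP => j; rewrite !mxE; apply: lin_ext => x.
  by case: (unlift ord0 j) => [i|] /=; rewrite [RHS]linear0.
pose a1 (j : 'I_n.+1) : A := if j == ord0 then (a : A) else 1.
pose y (j : 'I_n.+1) : Q := a1 j *: delta_mx 0 j.
have yE (c : 'I_n.+1 -> A) j : (\sum_i c i *: y i) 0 j = c j * a1 j.
  rewrite summxE (bigD1 j) //= big1 ?addr0 => [|i /negPf ij]; rewrite !mxE.
    by rewrite !eqxx mulr1.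
  by rewrite [j == i]eq_sym ij !mulr0.
have yP q : exists c, P (q - \sum_i c i *: y i).
  have rel : (b : A) * (a : A) + w h 0 ord0 = 1.
    by apply: lin_ext => x; rewrite mxE unlift_none; apply: abgh.
  (* In coordinate 0, the remainder $q_0-q_0ba$ (product of [A]) is $q_0$ times the coordinate of
     [w h], by [rel]. The other coefficients are set so that the whole remainder is
     [q 0 ord0 *: w h]. *)
  exists (fun j => if j == ord0 then q 0 ord0 * (b : A) else q 0 j - q 0 ord0 * w h 0 j).
  exists (h \o (q 0 ord0 : {linear N -> N}) : {linear N -> M}).
  transitivity (q 0 ord0 *: w h).
    apply/rowP => j; rewrite [LHS]mxE [X in _ + X]mxE yE [RHS]mxE /a1.
    case: eqP => [->|_]; last by rewrite mulr1 opprB addrC subrK.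
    by rewrite -mulrA -{1}[q 0 ord0]mulr1 -mulrBr -rel addrC addKr.
  rewrite -[LHS]addr0 (_ : 0 = w 0) ?w_lin ?addr0 //.
  apply/rowP => j; rewrite !mxE; apply: lin_ext => x.
  by case: (unlift ord0 j) => [i|] /=; rewrite [RHS]linear0.
have [p Xp k kn pk|bb [bb0 bbP]] := general_position genP jSupp_max
    (finite_minimal_primes noethN jSupp_bigcap) sP yP.
  have [T [hh [s [ps Ths]]]] := splF p Xp k pk.
  pose tau i (q : Q) : A^o := \sum_l q 0 (lift ord0 l) * (T i l : A).
  have tau_lin i : linear (tau i).
    move=> c q q'; rewrite /tau scaler_sumr -big_split; apply: eq_bigr => j _.
    by rewrite /= !mxE mulrDl -mulrA.
  (* The $k+1$ elements [w (hh i)] of [P] cut the $n+1$ standard generators down to $n-k$. *)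
  rewrite -subSS; apply: (generated_at_relations genP
    (y := fun j : 'I_n.+1 => delta_mx 0 j : Q)
    (T := fun i => mk_linear (tau_lin i)) (c := fun i => w (hh i)) (s := s)) => //.
  - by move=> q; exists (fun j => q 0 j); apply: row_sum_delta.
  - by move=> i; exists (hh i).
  - move=> i j; apply: lin_ext => x.
    transitivity (\sum_l T i l (F l (hh j x))).
      rewrite /= /tau linear_sumE; apply: eq_bigr => l' _.
      by rewrite mxE liftK.
    by rewrite Ths; case: eqP.
have [c [[k kE] cb]] := bbP (delta_mx 0 ord0).
have cE j : w k 0 j = (j == ord0)%:R - c j * a1 j.
  by rewrite -kE !mxE yE eqxx.
exists (\sum_i ((bb (lift ord0 i) : {linear N -> N}) \o F i : {linear M -> N})), k.
move=> x.
have appE (f f' : {linear N -> N}) : f = f' -> f x = f' x by move=> ->.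
have gk : g (k x) = x - a ((c ord0 : {linear N -> N}) x).
  have := cE ord0; rewrite mxE unlift_none /a1 eqxx mulr1n; exact: appE.
have Fk i : F i (k x) = - (c (lift ord0 i) : {linear N -> N}) x.
  have := cE (lift ord0 i); rewrite mxE liftK /a1 eq_sym (negPf (neq_lift _ _)).
  by rewrite mulr0n sub0r mulr1; apply: appE.
rewrite gk linear_sumE; set u := (\sum_i _); suff -> : u = (c ord0 : {linear N -> N}) x.
  by rewrite subrK.
have := cb; rewrite (bigD1_ord ord0) //= bb0 mulr1.
move/(appE _ (0 : {linear N -> N})) => cx.
apply/eqP; rewrite -subr_eq0 -oppr_eq0 opprB; apply/eqP.
rewrite -[RHS]cx [RHS]lin_addE; congr (_ + _).
rewrite linear_sumE /u -sumrN; apply: eq_bigr => i _.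
by rewrite /= Fk linearN opprK.
Qed.

(** When one copy of [N] is cancelled, the remaining copies are absorbed into [M]; the maps of [F]
    extend by zero. *)
Lemma splits_prod M n (F : 'I_n -> {linear M -> N}) (V : lmodType S^c) :
  splits F ->
  splits (fun l => F l \o (snd : {linear (V * M)%type -> M}) : {linear (V * M)%type -> N}).
Proof.
move=> splF p Xp k pk; have [T [h [s [ps Ths]]]] := splF p Xp k pk.
have h_lin j : linear (fun x => (0, h j x) : (V * M)%type).
  by move=> c x y; rewrite linearP; congr (_, _); rewrite /= scaler0 addr0.
by exists T, (fun j => mk_linear (h_lin j)), s.
Qed.

Lemma cancel_one L M n (F : 'I_n -> {linear M -> N}) : splits F ->
  isomorphic (N * L)%type (N * M)%type -> isomorphic L M.
Proof. by move=> splF; apply: cancellation_of_shift; apply: unimodular_shift splF. Qed.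

Lemma cancel_copies d L M n (F : 'I_n -> {linear M -> N}) : splits F ->
  isomorphic ({ffun 'I_d -> N} * L)%type ({ffun 'I_d -> N} * M)%type ->
  isomorphic L M.
Proof.
move=> splF; elim: d => [|d IHd] LM.
  apply: isomorphic_trans (isomorphic_ffun0 L N) _.
  by apply: isomorphic_trans LM _; apply/isomorphic_sym/isomorphic_ffun0.
have step (V : lmodType S^c) :
    isomorphic ({ffun 'I_d.+1 -> N} * V)%type (N * ({ffun 'I_d -> N} * V))%type.
  apply: isomorphic_trans (isomorphic_sym (isomorphic_prodA _ _ _)).
  apply: isomorphic_trans (isomorphic_prodC _ _) _.
  apply: isomorphic_trans (isomorphic_prodC _ _).
  exact/isomorphic_prod2l/isomorphic_ffunS.
apply/IHd/(cancel_one (splits_prod {ffun 'I_d -> N} splF)).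
apply: isomorphic_trans (isomorphic_sym (step L)) _.
by apply: isomorphic_trans LM _.
Qed.

Lemma cancel_summand K L M n (F : 'I_n -> {linear M -> N}) : splits F ->
  summand_of_copies K N ->
  isomorphic (K * L)%type (K * M)%type -> isomorphic L M.
Proof.
move=> splF [d [W KW]] KLM; apply: (cancel_copies (d := d) splF).
have step (V : lmodType S^c) :
    isomorphic ({ffun 'I_d -> N} * V)%type (W * (K * V))%type.
  apply: isomorphic_trans (isomorphic_sym (isomorphic_prodA _ _ _)).
  apply: isomorphic_trans (isomorphic_prodC _ _) _.
  apply: isomorphic_trans (isomorphic_prodC _ _).
  apply: isomorphic_prod2l; apply: isomorphic_trans (isomorphic_sym KW) _.
  exact: isomorphic_prodC.
apply: isomorphic_trans (step L) _.
by apply: isomorphic_trans (isomorphic_sym (step M)); apply: isomorphic_prod2l.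
Qed.

Lemma splits_of_split_surjections M (F : {pred {linear M -> N}}) :
  @finitely_generated_sub (Endo N) {linear M -> N} F ->
  (forall p : set_type X,
    (forall d : nat, krull_dim_is (point_closure p) d ->
       has_split_surjection (val p) alpha F (1 + d)%N) /\
    (krull_dim_infinite (point_closure p) ->
       forall n : nat, exists2 m : nat, (n <= m)%N &
         has_split_surjection (val p) alpha F m)) ->
  exists n (f : 'I_n -> {linear M -> N}), splits f.
Proof.
move=> [n [f [_ fP]]] spl; exists n, f => p Xp k pk.
pose q : set_type X := exist (fun p => p \in X) p (mem_set Xp).
(* A chain of length [k] forces dimension at least [k], finite or not, so at least [k.+1] components
   are available; the first [k.+1] are kept. *)
have [m km [h [hF h_split]]] : exists2 m, (k < m)%N & has_split_surjection p alpha F m.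
  have [fin inf] := spl q; have chk := has_chain_irr (p := q) pk.
  have [[d dP]|unbounded] :=
      pselect (exists d, forall n, has_irr_chain (point_closure q) n -> (n <= d)%N).
    pose D n := `[< has_irr_chain (point_closure q) n >].
    have exD : exists n, D n by exists k; apply/asboolP.
    have [|d' /asboolP chd' d'max] := ex_maxnP exD (m := d).
      by move=> n' /asboolP/dP.
    exists (1 + d')%N; last first.
      by apply: fin; split=> // n' /asboolP/d'max.
    by rewrite add1n ltnS d'max //; apply/asboolP.
  have [|m km mP] := inf _ k.+1; last by exists m.
  move=> d; apply: contrapT => nd; apply: unbounded; exists d => n' chn'.
  by rewrite leqNgt; apply/negP => /ltnW dn'; apply: nd; exists n'.
have [g [kk [s [gF ps gkk]]]] :=
  split_surjection_lift fpN (ex_intro _ h (conj hF h_split)).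
have /choice[c cP] := fun i => fP _ (gF i).
exists (fun i => c (widen_ord km i)), (fun i => kk (widen_ord km i)),
  (fun i => s (widen_ord km i)); split=> // i j x.
have -> : (i == j) = (widen_ord km i == widen_ord km j) by [].
rewrite -gkk [in RHS]cP linear_sumE; exact: eq_bigr.
Qed.

End Cancellation.

Theorem theorem1p2 (R : comPzRingType) (S : pzRingType) (alpha : algebra R S)
    (K L M N : lmodType S^c) :
  noetherian_space (set_type (jSupp alpha N)) ->
  finitely_presented N ->
  module_finite (end_alg alpha N) ->
  (exists F : {pred {linear M -> N}},
    [/\ @GRing.submod_closed (Endo N) {linear M -> N} F,
        @finitely_generated_sub (Endo N) {linear M -> N} F &
        forall p : set_type (jSupp alpha N),
          (forall d : nat, krull_dim_is (point_closure p) d ->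
             has_split_surjection (val p) alpha F (1 + d)%N) /\
          (krull_dim_infinite (point_closure p) ->
             forall n : nat, exists2 m : nat, (n <= m)%N &
               has_split_surjection (val p) alpha F m)]) ->
  (isomorphic (N * L)%type (N * M)%type -> isomorphic L M) /\
  (summand_of_copies K N ->
     isomorphic (K * L)%type (K * M)%type -> isomorphic L M).
Proof.
move=> noethN fpN mfN [F [_ fgF spl]].
have [n [f splf]] := splits_of_split_surjections fpN fgF spl.
by split; [apply: cancel_one splf | apply: cancel_summand splf].
Qed.
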